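(* Let $1\le p,\tilde p<\infty$, $1\le q\le\infty$, $\alpha\in\mathbb{R}$, $0\le\lambda<\frac{n+\alpha}{\tilde p}$, with $\lambda>0$ if $q<\infty$ (and $\lambda\ge0$ if $q=\infty$). Then the dual Hardy operator $\mathcal H^*$ is bounded on $LML_{rad}^{\tilde p,\lambda,q}L_{ang}^{p}(\mathbb{R}^n,|x|^\alpha)$, that is, $$\|\mathcal H^*(f)\|_{LML_{rad}^{\tilde p,\lambda,q}L_{ang}^{p}(\mathbb{R}^n,|x|^\alpha)}\le\frac{n\tilde p}{n+\alpha-\lambda\tilde p}\,\|f\|_{LML_{rad}^{\tilde p,\lambda,q}L_{ang}^{p}(\mathbb{R}^n,|x|^\alpha)}.$$ Moreover, the operator norm of $\mathcal H^*$ on $LML_{rad}^{\tilde p,\lambda,q}L_{ang}^{p}(\mathbb{R}^n,|x|^\alpha)$ equals $\frac{n\tilde p}{n+\alpha-\lambda\tilde p}$.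
   Context: Let $n\ge2$ and let $\mathbb{S}^{n-1}$ be the unit sphere of $\mathbb{R}^n$ with surface measure $\sigma$. The dual Hardy operator is $$\mathcal H^*(f)(x)=\int_{|y|>|x|}\frac{f(y)}{|B(0,|y|)|}\,dy,\qquad x\in\mathbb{R}^n,$$ where $B(0,r)$ is the ball of radius $r$ centered at the origin. For $0<p,\tilde p<\infty$, $0<q\le\infty$, $0\le\lambda<\infty$, $\alpha\in\mathbb{R}$, and measurable $f$ on $\mathbb{R}^n$, put for $r>0$ $$N_r(f)=\Big(\int_0^r\Big(\int_{\mathbb{S}^{n-1}}|f(\rho\theta)|^p\,d\sigma(\theta)\Big)^{\tilde p/p}\rho^{n-1+\alpha}\,d\rho\Big)^{1/\tilde p}.$$ The mixed radial-angular local Morrey-type space $LML_{rad}^{\tilde p,\lambda,q}L_{ang}^{p}(\mathbb{R}^n,|x|^\alpha)$ is the set of measurable $f$ for which the following quantity is finite: $$\|f\|_{LML_{rad}^{\tilde p,\lambda,q}L_{ang}^{p}(\mathbb{R}^n,|x|^\alpha)}=\Big(\int_0^\infty\big(r^{-\lambda}N_r(f)\big)^q\frac{dr}{r}\Big)^{1/q}\ (q<\infty),\qquad \sup_{r>0}r^{-\lambda}N_r(f)\ (q=\infty).$$ *)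

(* Defs.v *)
From HB Require Import structures.
From mathcomp Require Import all_boot all_order all_algebra.
From mathcomp Require Import all_classical all_reals all_analysis.
From mathcomp Require Import measurable_realfun.

Set Implicit Arguments.
Unset Strict Implicit.
Unset Printing Implicit Defensive.

Import Order.TTheory GRing.Theory Num.Theory.
Import numFieldNormedType.Exports.

Local Open Scope classical_set_scope.
Local Open Scope ring_scope.

(* n-tuples carry the product Borel sigma-algebra, unlike row vectors, which
   have no measurable structure in the library. *)
Notation Rn R n := (n.-tuple R).

Section lebesgue_measure_Rn.
Context {R : realType}.
Local Open Scope ereal_scope.

Definition tcons n (z : R * Rn R n) : Rn R n.+1 :=
  [tuple of z.1 :: z.2].

Lemma measurable_tcons n :
  measurable_fun [set: R * Rn R n] (@tcons n).
Proof.
by apply: measurable_cons; [exact: measurable_fst|exact: measurable_snd].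
Qed.

Section step.
Variables (n : nat) (mu : {sigma_finite_measure set (Rn R n) -> \bar R}).

Definition leb_step : set (Rn R n.+1) -> \bar R :=
  pushforward (@lebesgue_measure R \x mu) (@tcons n).

Let leb_step0 : leb_step set0 = 0.
Proof. by rewrite /leb_step /pushforward preimage_set0 measure0. Qed.

Let leb_step_ge0 A : 0 <= leb_step A.
Proof. by rewrite /leb_step /pushforward; exact: measure_ge0. Qed.

Let leb_step_sigma_additive : semi_sigma_additive leb_step.
Proof.
move=> F mF tF mUF; rewrite /leb_step /pushforward preimage_bigcup.
have mpre A : measurable A -> measurable (@tcons n @^-1` A).
  by move=> mA; rewrite -[X in measurable X]setTI; exact: measurable_tcons.
apply: measure_semi_sigma_additive.
- by move=> i; exact: mpre.
- apply/trivIsetP => /= i j _ _ ij; rewrite -preimage_setI.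
  by move/trivIsetP : tF => /(_ _ _ _ _ ij) ->//; rewrite preimage_set0.
- by rewrite -preimage_bigcup; exact: mpre.
Qed.

HB.instance Definition _ := isMeasure.Build _ _ _ leb_step
  leb_step0 leb_step_ge0 leb_step_sigma_additive.

Let leb_step_sigma_finite : sigma_finite setT leb_step.
Proof.
have [F FT Fy] : sigma_finite setT (@lebesgue_measure R \x mu).
  have /sigma_finiteP[F [TF ndF Foo]] :=
    sigma_finiteT (@lebesgue_measure R : {sigma_finite_measure set _ -> \bar R}).
  have /sigma_finiteP[G [TG ndG Goo]] := sigma_finiteT mu.
  exists (fun i => F i `*` G i).
    rewrite -setXTT TF TG predeqE => -[x y]; split.
      move=> [/= [i _ Fx] [k _ Gky]]; exists (maxn i k) => //; split.
      - by move: x Fx; exact/subsetPset/ndF/leq_maxl.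
      - by move: y Gky; exact/subsetPset/ndG/leq_maxr.
    by move=> [i _ []/= ? ?]; split; exists i.
  move=> k; have [? ?] := Foo k; have [? ?] := Goo k.
  split; first exact: measurableX.
  by rewrite product_measure1E// lte_mul_pinfty// ge0_fin_numE.
have consK : cancel (@tcons n) (fun t => (thead t, [tuple of behead t])).
  by move=> [x t]; rewrite /tcons/= theadE; congr pair; apply/val_inj.
have consK' : cancel (fun t => (thead t, [tuple of behead t])) (@tcons n).
  by move=> t; rewrite /tcons/= [RHS]tuple_eta.
pose g (t : Rn R n.+1) := (thead t, [tuple of behead t]).
have mg : measurable_fun [set: Rn R n.+1] g.
  apply/measurable_fun_pairP; split; first exact: measurable_tnth.
  exact: measurable_behead.
exists (fun i => g @^-1` F i).
  by rewrite -preimage_bigcup -FT preimage_setT.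
move=> i; have [mF Foo] := Fy i; split.
  by rewrite -[X in measurable X]setTI; exact: mg.
rewrite /leb_step /pushforward -comp_preimage.
by rewrite (_ : g \o _ = id) //; apply/funext => z /=; exact: consK.
Qed.

HB.instance Definition _ := Measure_isSigmaFinite.Build _ _ _ leb_step
  leb_step_sigma_finite.

End step.

Fixpoint leb n : {sigma_finite_measure set (Rn R n) -> \bar R} :=
  if n is m.+1 return {sigma_finite_measure set (Rn R n) -> \bar R}
  then leb_step (leb m)
  else \d_([tuple] : Rn R 0).

End lebesgue_measure_Rn.
Arguments leb R n : clear implicits.

Section euclidean.
Context {R : realType} {n : nat}.

Definition enorm (x : Rn R n) : R := Num.sqrt (\sum_(i < n) tnth x i ^+ 2).

Definition tscale (a : R) (x : Rn R n) : Rn R n := [tuple a * tnth x i | i < n].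

Definition eball (r : R) : set (Rn R n) := [set x | enorm x < r].

Definition esphere : set (Rn R n) := [set x | enorm x = 1].

Definition punctured_ball : set (Rn R n) := [set x | 0 < enorm x <= 1].

(* [direction x] is x / |x|; it is 0 at x = 0. *)
Definition direction (x : Rn R n) : Rn R n := tscale (enorm x)^-1 x.

Lemma measurable_enorm : measurable_fun [set: Rn R n] enorm.
Proof.
rewrite (_ : enorm = fun x => (\sum_(i < n) tnth x i ^+ 2) `^ 2^-1).
  apply: (@measurableT_comp _ _ _ _ _ _ (@powR R ^~ 2^-1) _
    (fun x : Rn R n => \sum_(i < n) tnth x i ^+ 2)) => //.
  by apply: measurable_sum => i; apply: measurable_funX; exact: measurable_tnth.
by apply/funext => x; rewrite powR12_sqrt// sumr_ge0// => i _; exact: sqr_ge0.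
Qed.

Lemma measurable_punctured_ball : measurable punctured_ball.
Proof.
rewrite (_ : punctured_ball = enorm @^-1` `]0, 1]).
  by rewrite -[X in measurable X]setTI; apply: measurable_enorm.
by apply/seteqP; split => x /=; rewrite in_itv.
Qed.

Lemma measurable_direction : measurable_fun [set: Rn R n] direction.
Proof.
apply/measurable_fun_tnthP => i.
rewrite (_ : _ \o _ = fun x => (enorm x)^-1 * tnth x i); last first.
  by apply/funext => x /=; rewrite tnth_mktuple.
apply: measurable_funM; last exact: measurable_tnth.
rewrite (_ : (fun _ => _) = fun x => enorm x `^ (-1)).
  apply: (@measurableT_comp _ _ _ _ _ _ (@powR R ^~ (-1)) _ enorm) => //.
  exact: measurable_enorm.
by apply/funext => x; rewrite powR_inv1// sqrtr_ge0.
Qed.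

Local Open Scope ereal_scope.

(* The surface measure of the unit sphere, seen as a measure on R^n: the
   measure of A is n times the volume of the cone
   { t theta | 0 < t <= 1, theta in A, |theta| = 1 }, as dictated by integration
   in polar coordinates. *)
Definition sigma (A : set (Rn R n)) : \bar R :=
  n%:R%:E * leb R n (punctured_ball `&` direction @^-1` A).

Let sigma0 : sigma set0 = 0.
Proof. by rewrite /sigma preimage_set0 setI0 measure0 mule0. Qed.

Let sigma_ge0 A : 0 <= sigma A.
Proof. by rewrite /sigma mule_ge0// lee_fin. Qed.

Let sigma_semi_sigma_additive : semi_sigma_additive sigma.
Proof.
move=> F mF tF mUF.
have mcone A : measurable A -> measurable (punctured_ball `&` direction @^-1` A).
  move=> mA; apply: measurableI; first exact: measurable_punctured_ball.
  by rewrite -[X in measurable X]setTI; exact: measurable_direction.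
rewrite /sigma preimage_bigcup setI_bigcupr.
rewrite (_ : (fun _ => _) = (fun k => n%:R%:E * \sum_(0 <= i < k)
    leb R n (punctured_ball `&` direction @^-1` F i))); last first.
  apply/funext => k; rewrite ge0_sume_distrr//.
apply: cvgeZl => //; apply: measure_semi_sigma_additive.
- by move=> i; exact: mcone.
- apply/trivIsetP => /= i j _ _ ij; rewrite setIACA -preimage_setI.
  by move/trivIsetP : tF => /(_ _ _ _ _ ij) ->//; rewrite preimage_set0 setI0.
- by rewrite -setI_bigcupr -preimage_bigcup; exact: mcone.
Qed.

HB.instance Definition _ := isMeasure.Build _ _ _ sigma
  sigma0 sigma_ge0 sigma_semi_sigma_additive.

(* Functions take values in [-oo, +oo], so that the integral below is a total
   operation; it is finite exactly when the integrand is integrable (in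
   particular +oo - (+oo) = -oo). *)
Definition dual_hardy (f : Rn R n -> \bar R) (x : Rn R n) : \bar R :=
  \int[leb R n]_(y in [set y | (enorm x < enorm y)%R])
    (f y / leb R n (eball (enorm y))).

(* Measurability for the completed Lebesgue sigma-algebra: the sigma-algebra
   carried by the type [Rn R n] is only the Borel one. *)
Definition lebesgue_measurable (f : Rn R n -> \bar R) : Prop :=
  exists2 g : Rn R n -> \bar R, measurable_fun [set: Rn R n] g &
    {ae leb R n, forall x, f x = g x}.

Section space.
Variables (pt lam : R) (q : \bar R) (p alpha : R).

Definition local_norm (r : R) (f : Rn R n -> \bar R) : \bar R :=
  (\int[lebesgue_measure]_(rho in `]0%R, r[)
     ((\int[sigma]_(theta in esphere) (`|f (tscale rho theta)| `^ p))
        `^ (pt / p) * (rho `^ (n%:R - 1 + alpha))%:E)) `^ pt^-1.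

(* Only 0 < q is meaningful; the value at -oo is a placeholder. *)
Definition LML_norm (f : Rn R n -> \bar R) : \bar R :=
  match q with
  | q'%:E =>
    (\int[lebesgue_measure]_(r in `]0%R, +oo[)
       (((r `^ (- lam))%:E * local_norm r f) `^ q' * (r^-1)%:E)) `^ q'^-1
  | +oo => ereal_sup [set (r `^ (- lam))%:E * local_norm r f | r in `]0%R, +oo[]
  | -oo => 0
  end.

Definition LML : set (Rn R n -> \bar R) :=
  [set f | lebesgue_measurable f /\ LML_norm f < +oo].

Definition operator_norm (T : (Rn R n -> \bar R) -> (Rn R n -> \bar R)) : \bar R :=
  ereal_inf [set C%:E | C in [set C : R |
    (0 <= C)%R /\ forall f, LML f -> LML_norm (T f) <= C%:E * LML_norm f]].

End space.

End euclidean.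

(* Main.v *)
(* In polar coordinates H* becomes a one-dimensional operator. If
   G(s) = (\int_{S^(n-1)} |f(s theta)|^p dsigma)^(1/p), Hoelder's inequality on
   the sphere, whose area is n |B(0,1)|, bounds the angular norm of H*f at
   radius rho by n \int_rho^oo G(s) ds/s = n \int_1^oo G(t rho) dt/t.
   Two applications of Minkowski's integral inequality and the homogeneity of
   the norms under dilations then give
     ||H*f|| <= n \int_1^oo t^(-1-a) dt ||f|| = (n/a) ||f||,
   where a = (n+alpha)/pt - lam.
   For the converse, the truncated powers f(x) = |x|^(-b) for |x| > 1, with
   b > a, satisfy H*f >= (n/b) f pointwise and have finite positive norm for b
   close to a; let b decrease to a. *)

Require Import Defs.
From HB Require Import structures.
From mathcomp Require Import all_boot all_order all_algebra.
From mathcomp Require Import all_classical all_reals all_analysis.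
From mathcomp Require Import measurable_realfun ring lra.

Set Implicit Arguments.
Unset Strict Implicit.
Unset Printing Implicit Defensive.

Import Order.TTheory GRing.Theory Num.Theory.
Import numFieldNormedType.Exports.

Local Open Scope classical_set_scope.
Local Open Scope ring_scope.

(** A Lebesgue measurable f need not be measurable on every sphere, while the norm is an iterated
    integral over spheres. Hence the comparisons of integrals for arbitrary nonnegative functions,
    and the passage to a Borel representative, which changes neither H*f nor any norm. Local norms
    may vanish, so Minkowski's inequality is used with positive real majorants, each enlarged by a
    small term that finally tends to 0. Real majorants exist because local norms increase with r: a
    finite Morrey norm makes all of them finite. For the test functions, truncation is free since H*
    only looks outward, and it removes the origin, where r^(-lam) times the local norm of the full
    power is unbounded once b > a. At b = a the truncated power fails at infinity: its weighted
    local norm tends to a positive constant if lam > 0, excluded for finite q, and grows like a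
    power of log r if lam = 0. For lam = 0 and finite q, monotonicity in r would leave only
    functions of norm zero, so that no test function could exist. *)

Lemma measurable_EFin_powR d (T : measurableType d) (R : realType)
    (f : T -> R) (r : R) : measurable_fun setT f ->
  measurable_fun setT (fun x => (f x `^ r)%:E).
Proof.
move=> mf; apply/measurable_EFinP.
by apply: (@measurableT_comp _ _ _ _ _ _ (@powR R ^~ r)).
Qed.

(** * Integrals of functions that need not be measurable *)

Section nonmeasurable_integrand.
Local Open Scope ereal_scope.
Context d (T : measurableType d) (R : realType).
Variable mu : {measure set T -> \bar R}.
Implicit Types (D : set T) (f g : T -> \bar R).

Import HBNNSimple.

(* The library's comparison lemmas ask for measurable integrands, but the
   integral of a nonnegative function is a supremum over the simple functions
   below it, which makes sense for all functions. *)
Lemma ae_ge0_le_integral_nonmeasurable D f g :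
  (forall x, D x -> 0 <= f x) -> (forall x, D x -> 0 <= g x) ->
  {ae mu, forall x, D x -> f x <= g x} ->
  \int[mu]_(x in D) f x <= \int[mu]_(x in D) g x.
Proof.
move=> f0 g0 [N [mN N0 fgN]].
rewrite (integral_mkcond D f) (integral_mkcond D g).
have fD0 x : 0 <= (f \_ D) x by rewrite erestrict_ge0.
have gD0 x : 0 <= (g \_ D) x by rewrite erestrict_ge0.
rewrite ge0_integralTE//; apply: ge_ereal_sup => _ /= [h hf <-].
rewrite -integralT_nnsfun.
have mNC : measurable (~` N) by exact: measurableC.
(* Killing [h] on the exceptional null set keeps its integral and puts it below [g] everywhere on
   [D]. *)
pose k : {nnsfun T >-> R} := proj_nnsfun h mNC.
have -> : \int[mu]_x (h x)%:E = \int[mu]_x (k x)%:E.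
  apply: ge0_ae_eq_integral => //.
  - exact/measurable_EFinP.
  - exact/measurable_EFinP.
  - by move=> x _; rewrite lee_fin.
  - by move=> x _; rewrite lee_fin.
  - exists N; split => // x /= /not_implyP[_]; apply: contra_notP => Nx.
    by rewrite /k /= mindicE mem_set// mulr1.
rewrite integralT_nnsfun ge0_integralTE//; apply: ereal_sup_ubound => /=.
exists k => // x; rewrite /k /= mindicE.
have [xN|xN] := boolP (x \in ~` N); last by rewrite mulr0.
rewrite mulr1 (le_trans (hf x))// /patch; case: ifPn => // /set_mem xD.
by apply: contrapT => fg; move/set_mem : xN; apply; apply: fgN => /= /(_ xD).
Qed.

Lemma ge0_le_integral_nonmeasurable D f g :
  (forall x, D x -> 0 <= f x) -> (forall x, D x -> f x <= g x) ->
  \int[mu]_(x in D) f x <= \int[mu]_(x in D) g x.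
Proof.
move=> f0 fg; apply: ae_ge0_le_integral_nonmeasurable => //; last exact: aeW.
by move=> x Dx; exact: le_trans (f0 x Dx) (fg x Dx).
Qed.

Lemma ge0_ae_eq_integral_nonmeasurable D f g :
  (forall x, D x -> 0 <= f x) -> (forall x, D x -> 0 <= g x) ->
  {ae mu, forall x, D x -> f x = g x} ->
  \int[mu]_(x in D) f x = \int[mu]_(x in D) g x.
Proof.
move=> f0 g0 fg; apply/eqP; rewrite eq_le !ae_ge0_le_integral_nonmeasurable//.
  by apply: filterS fg => x /[apply] ->.
by apply: filterS fg => x /[apply] ->.
Qed.

Lemma ae_eq_integral_nonmeasurable D f g :
  {ae mu, forall x, D x -> f x = g x} ->
  \int[mu]_(x in D) f x = \int[mu]_(x in D) g x.
Proof.
move=> fg; rewrite integralE [RHS]integralE; congr (_ - _);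
  by apply: ge0_ae_eq_integral_nonmeasurable => //;
    apply: filterS fg => x /[apply];
    rewrite ?funeposE ?funenegE => ->.
Qed.

(** Scaling the simple functions below the integrand gives one inequality for every positive
    constant; the other is that inequality for 1/c applied to c f. *)
Lemma integralZl_nonmeasurable D f (c : R) : (0 < c)%R ->
  (forall x, D x -> 0 <= f x) ->
  \int[mu]_(x in D) (c%:E * f x) = c%:E * \int[mu]_(x in D) f x.
Proof.
have ge0Z (k : R) h : (0 < k)%R -> (forall x, 0 <= h x) ->
    k%:E * \int[mu]_x h x <= \int[mu]_x (k%:E * h x).
  move=> k0 h0; rewrite ge0_integralTE// muleC -lee_pdivlMr//.
  apply: ge_ereal_sup => _ [/= s sh <-]; rewrite lee_pdivlMr// muleC.
  pose k' : {nonneg R} := NngNum (ltW k0).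
  have -> : k%:E * sintegral mu s = sintegral mu (scale_nnsfun s (ltW k0)).
    by rewrite -sintegralrM.
  rewrite ge0_integralTE; last by move=> x; rewrite mule_ge0// lee_fin ltW.
  apply: ereal_sup_ubound => /=; exists (scale_nnsfun s (ltW k0)) => // x /=.
  by rewrite EFinM lee_pmul2l// sh.
move=> c0 f0; rewrite (integral_mkcond D f) integral_mkcond.
have fD0 x : 0 <= (f \_ D) x by rewrite erestrict_ge0.
have -> : (fun x => c%:E * f x) \_ D = (fun x => c%:E * (f \_ D) x).
  by apply/funext => x; rewrite /patch; case: ifP => // _; rewrite mule0.
apply/eqP; rewrite eq_le ge0Z// andbT.
have cK x : (c^-1)%:E * (c%:E * (f \_ D) x) = (f \_ D) x.
  by rewrite muleA -EFinM mulVf ?gt_eqF// mul1e.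
have := ge0Z (c^-1)%R (fun x => c%:E * (f \_ D) x).
rewrite invr_gt0 => /(_ c0); under [X in _ -> _ <= X]eq_integral do rewrite cK.
rewrite muleC lee_pdivrMr// muleC; apply => x.
by rewrite mule_ge0// lee_fin ltW.
Qed.

Lemma integral_gt0 D f : measurable D -> 0 < mu D ->
  measurable_fun D f -> (forall x, D x -> 0 < f x) ->
  0 < \int[mu]_(x in D) f x.
Proof.
move=> mD muD mf f0; rewrite lt0e integral_ge0 ?andbT; last first.
  by move=> x /f0/ltW.
apply/eqP => I0.
have /(ae_eq_integral_abs mu mD mf) [N [mN N0 DN]] :
    \int[mu]_(x in D) `|f x| = 0.
  by rewrite -I0; apply: eq_integral => x /[!inE] /f0 /ltW/gee0_abs.
have : mu D <= mu N.
  apply: le_measure; rewrite ?inE// => x Dx; apply: DN => /= /(_ Dx) fx0.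
  by have := f0 _ Dx; rewrite fx0 ltxx.
by rewrite N0 leNgt muD.
Qed.

End nonmeasurable_integrand.

(** * Minkowski's integral inequality *)

(** The tangent line to x ^ p at M, solved for x. It is Young's inequality for x / M and 1, whose
    conjugate exponent is finite only for p > 1. *)
Lemma le_powR_tangent {R : realType} (p x M : R) : 1 <= p -> 0 <= x -> 0 < M ->
  x <= M `^ (1 - p) / p * x `^ p + (1 - p^-1) * M.
Proof.
move=> p1 x0 M0; have p0 : 0 < p by exact: lt_le_trans p1.
have [->|pN1] := eqVneq p 1.
  by rewrite subrr powRr0 powRr1// !invr1 subrr mul0r !mul1r addr0.
have p1' : 1 < p by rewrite lt_neqAle eq_sym pN1.
have q0 : 0 < 1 - p^-1 by rewrite subr_gt0 invf_lt1.
have := @conjugate_powR R (x / M) 1 p (1 - p^-1)^-1 (divr_ge0 x0 (ltW M0))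
  ler01 p0.
rewrite invr_gt0 invrK => /(_ q0); rewrite addrC subrK => /(_ erefl).
rewrite powR1 mul1r mulr1 -(ler_pM2r M0) mulfVK ?gt_eqF// => /le_trans; apply.
rewrite mulrDl lerD2r powRM// ?invr_ge0 ?(ltW M0)// -powR_inv1 ?(ltW M0)//.
rewrite -powRrM mulN1r powRD; last by rewrite (gt_eqF M0) implybT.
by rewrite powRr1 ?(ltW M0)// le_eqVlt; apply/orP; left; apply/eqP; ring.
Qed.

Section minkowski.
Local Open Scope ereal_scope.
Context {R : realType}.

(* Jensen's inequality for the weight [w], by integrating the tangent line
   inequality at a point [M] with [J <= M ^ p * c], and then letting [M]
   decrease to [(J / c) ^ p^-1] (which may be [0]). *)
Lemma jensen_poweR d (T : measurableType d) (mu : {measure set T -> \bar R})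
    (D : set T) (u : T -> \bar R) (w : T -> R) (p c : R) :
  measurable D -> measurable_fun D u -> measurable_fun D w ->
  (forall x, D x -> 0 <= u x) -> (forall x, D x -> 0 <= w x)%R ->
  (1 <= p)%R -> (0 < c)%R -> \int[mu]_(x in D) (w x)%:E = c%:E ->
  (\int[mu]_(x in D) (u x * (w x)%:E)) `^ p <=
    (c `^ (p - 1))%:E * \int[mu]_(x in D) (u x `^ p * (w x)%:E).
Proof.
move=> mD mu_ mw u0 w0 p1 c0 wc; have p0 : (0 < p)%R by exact: lt_le_trans p1.
set J := (X in _ <= _ * X); set K := (X in X `^ p <= _).
have J0 : 0 <= J.
  by apply: integral_ge0 => x Dx; rewrite mule_ge0 ?poweR_ge0// lee_fin w0.
have K0 : 0 <= K.
  by apply: integral_ge0 => x Dx; rewrite mule_ge0 ?u0// lee_fin w0.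
have mJ : measurable_fun D (fun x => u x `^ p * (w x)%:E).
  apply: emeasurable_funM; last exact/measurable_EFinP.
  exact: measurableT_comp (measurable_poweR p) mu_.
have [Joo|] := eqVneq J +oo.
  by rewrite Joo gt0_muley ?leey// lte_fin powR_gt0.
rewrite -ltey => Joo.
(* At [J] equal to M ^ p * c the integrated tangent line has exactly the value M c. *)
have KM (M : R) : (0 < M)%R -> J <= (M `^ p * c)%:E -> K <= (M * c)%:E.
  move=> M0 JM.
  have -> : (M * c)%:E = (M `^ (1 - p) / p)%:E * (M `^ p * c)%:E +
                          ((1 - p^-1) * M)%:E * c%:E.
    rewrite -!EFinM -EFinD; congr EFin.
    have -> : (M `^ (1 - p) / p * (M `^ p * c) =
        (M `^ (1 - p) * M `^ p) * c / p)%R by ring.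
    rewrite -powRD; last by rewrite subrK oner_eq0.
    by rewrite subrK powRr1 ?ltW//; ring.
  apply: (@le_trans _ _ ((M `^ (1 - p) / p)%:E * J + ((1 - p^-1) * M)%:E *
    c%:E)).
    rewrite -wc -[X in X + _]ge0_integralZl//; last 2 first.
    - by move=> x Dx; rewrite mule_ge0 ?poweR_ge0// lee_fin w0.
    - by rewrite lee_fin mulr_ge0 ?powR_ge0// invr_ge0 ltW.
    rewrite -[X in _ + X]ge0_integralZl//; last 2 first.
    - exact/measurable_EFinP.
    - by rewrite lee_fin mulr_ge0 ?(ltW M0)// subr_ge0 invf_le1.
    rewrite -ge0_integralD//; last 4 first.
    - move=> x Dx; rewrite mule_ge0 ?mule_ge0 ?poweR_ge0// lee_fin ?w0//.
      by rewrite mulr_ge0 ?powR_ge0// invr_ge0 ltW.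
    - by apply: emeasurable_funM => //; exact: measurable_cst.
    - move=> x Dx; rewrite lee_fin mulr_ge0 ?w0// mulr_ge0 ?(ltW M0)//.
      by rewrite subr_ge0 invf_le1.
    - by apply/measurable_EFinP; apply: measurable_funM => //;
      exact: measurable_cst.
    apply: ge0_le_integral_nonmeasurable => x Dx;
      first by rewrite mule_ge0 ?u0// lee_fin w0.
    have := u0 x Dx; case: (u x) => [v v0|_|//].
      rewrite /= -!EFinM -EFinD lee_fin mulrA -mulrDl ler_wpM2r ?w0//.
      exact: le_powR_tangent.
    (* Here [u x] is infinite: both sides are 0 if the weight vanishes, since 0 * oo = 0, and
       otherwise the right-hand side is infinite. *)
    rewrite poweRyr ?gt_eqF//; have := w0 x Dx;
      rewrite le_eqVlt => /predU1P[<-|wx0].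
      by rewrite !mule0 adde0.
    rewrite gt0_mulye// gt0_muley; first by rewrite addye// leey.
    by rewrite lte_fin divr_gt0// powR_gt0.
  rewrite leeD2r// lee_pmul2l// lte_fin divr_gt0// powR_gt0//.
apply/lee_addgt0Pr => e e0; have Jfin : J \is a fin_num by rewrite ge0_fin_numE.
pose j := fine J; have j0 : (0 <= j)%R by exact: fine_ge0.
(* The bound (M c) ^ p will equal c ^ (p - 1) * (j + e'), in which this e' contributes exactly e. *)
pose e' := (e / c `^ (p - 1))%R.
have e'0 : (0 < e')%R by rewrite divr_gt0// powR_gt0.
pose M := (((j + e') / c) `^ p^-1)%R.
have M0 : (0 < M)%R by rewrite powR_gt0// divr_gt0// ltr_wpDl.
have MpE : (M `^ p = (j + e') / c)%R.
  rewrite /M -powRrM mulVf ?gt_eqF// powRr1// divr_ge0 ?(ltW c0)//.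
  by rewrite addr_ge0 ?(ltW e'0).
have KMc : K <= (M * c)%:E.
  apply: KM => //; rewrite MpE mulfVK ?gt_eqF// EFinD fineK//.
  by rewrite leeDl// lee_fin ltW.
apply: (@le_trans _ _ ((M * c)%:E `^ p)).
  apply: gt0_ler_poweR => //; rewrite ?in_itv/= ?leey ?andbT ?(ltW p0)//.
  by rewrite lee_fin mulr_ge0 ?(ltW M0) ?(ltW c0).
rewrite poweR_EFin powRM ?(ltW M0) ?(ltW c0)// MpE -[J]fineK// -/j.
rewrite -EFinM -EFinD lee_fin.
have -> : (c `^ p = c `^ (p - 1) * c)%R.
  rewrite -[X in (_ * X)%R]powRr1 ?(ltW c0)// -powRD ?subrK//.
  by rewrite (gt_eqF p0).
have -> : ((j + e') / c * (c `^ (p - 1) * c) =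
    c `^ (p - 1) * j + e' * c `^ (p - 1))%R by field; rewrite gt_eqF.
by rewrite /e' mulfVK// gt_eqF// powR_gt0.
Qed.

Context d1 d2 (T1 : measurableType d1) (T2 : measurableType d2).
Variable m1 : {sigma_finite_measure set T1 -> \bar R}.
Variable m2 : {sigma_finite_measure set T2 -> \bar R}.
Variables (D1 : set T1) (D2 : set T2).
Hypotheses (mD1 : measurable D1) (mD2 : measurable D2).

Lemma measurable_fun_integral2 (f : T1 * T2 -> \bar R) :
  measurable_fun setT f -> (forall z, 0 <= f z) ->
  measurable_fun setT (fun x => \int[m2]_(y in D2) f (x, y)).
Proof.
move=> mf f0; pose g z := (f \_ (setT `*` D2)) z.
have mg : measurable_fun setT g.
  apply/(measurable_restrictT _ _).1; first exact: measurableX.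
  exact: measurable_funS mf.
rewrite (_ : (fun x => _) = (fun x => \int[m2]_y g (x, y))).
  apply: (measurable_fun_fubini_tonelli_F g) => // z.
  by rewrite erestrict_ge0.
apply/funext => x; rewrite integral_mkcond; apply: eq_integral => y _.
rewrite /g /patch.
suff -> : ((x, y) \in [set: T1] `*` D2) = (y \in D2) by [].
by apply/idP/idP => /[!inE]; [case|move=> ?; split].
Qed.

Lemma fubini_tonelli_in (f : T1 * T2 -> \bar R) :
  measurable_fun setT f -> (forall z, 0 <= f z) ->
  \int[m1]_(x in D1) \int[m2]_(y in D2) f (x, y) =
  \int[m2]_(y in D2) \int[m1]_(x in D1) f (x, y).
Proof.
move=> mf f0; pose g z := (f \_ (D1 `*` D2)) z.
have mg : measurable_fun setT g.
  apply/(measurable_restrictT _ _).1; first exact: measurableX.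
  exact: measurable_funS mf.
have g0 z : 0 <= g z by rewrite erestrict_ge0.
have gE x y : g (x, y) = if (x \in D1) && (y \in D2) then f (x, y) else 0.
  rewrite /g /patch.
  suff -> : ((x, y) \in D1 `*` D2) = (x \in D1) && (y \in D2) by [].
  by apply/idP/andP => /[!inE].
transitivity (\int[m1]_x \int[m2]_y g (x, y)).
  rewrite integral_mkcond; apply: eq_integral => x _; rewrite /patch.
  under [RHS]eq_integral do rewrite gE.
  by case: (x \in D1) => /=; [rewrite integral_mkcond|rewrite integral0].
rewrite fubini_tonelli//; apply/esym.
rewrite integral_mkcond; apply: eq_integral => y _; rewrite /patch.
under [RHS]eq_integral do rewrite gE andbC.
by case: (y \in D2) => /=; [rewrite integral_mkcond|rewrite integral0].
Qed.

(* [phi y] is any positive majorant of the norm of [F (., y)]: Jensen's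
   inequality for the weight [phi] needs no care for slices of norm zero. *)
Lemma minkowski_integral (F : T1 * T2 -> \bar R) (phi : T2 -> R) (p c : R) :
  measurable_fun setT F -> (forall z, 0 <= F z) ->
  measurable_fun setT phi -> (forall y, D2 y -> 0 < phi y)%R ->
  (1 <= p)%R -> (0 < c)%R -> \int[m2]_(y in D2) (phi y)%:E = c%:E ->
  (forall y, D2 y -> \int[m1]_(x in D1) (F (x, y) `^ p) <= (phi y `^ p)%:E) ->
  \int[m1]_(x in D1) ((\int[m2]_(y in D2) F (x, y)) `^ p) <= (c `^ p)%:E.
Proof.
move=> mF F0 mphi phi0 p1 c0 phic Fphi.
have p0 : (0 < p)%R by exact: lt_le_trans p1.
have mpowphi r : measurable_fun setT (fun y => (phi y `^ r)%R).
  by apply: (@measurableT_comp _ _ _ _ _ _ (@powR R ^~ r)).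
(* Jensen is applied to F / phi with weight phi, and (F / phi) ^ p * phi = [H]. After Tonelli, the
   hypothesis on slices bounds the inner integral of [H] by phi ^ (1 - p) * phi ^ p = phi. *)
pose H z := F z `^ p * (phi z.2 `^ (1 - p))%:E.
have H0 z : 0 <= H z by rewrite mule_ge0 ?poweR_ge0// lee_fin powR_ge0.
have mH : measurable_fun setT H.
  apply: emeasurable_funM; first exact: measurableT_comp (measurable_poweR p)
    mF.
  apply/measurable_EFinP.
  exact: (measurableT_comp (mpowphi (1 - p)%R) measurable_snd).
have phiE y : D2 y -> ((phi y)^-1 * phi y = 1)%R.
  by move=> /phi0 ?; rewrite mulVf// gt_eqF.
have jensenF x : (\int[m2]_(y in D2) F (x, y)) `^ p <=
    (c `^ (p - 1))%:E * \int[m2]_(y in D2) H (x, y).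
  have mFx : measurable_fun D2 (fun y => F (x, y) * ((phi y) `^ (-1))%:E).
    apply: emeasurable_funM; first exact/measurable_funTS/measurableT_comp.
    by apply/measurable_EFinP; exact: measurable_funTS.
  have -> : \int[m2]_(y in D2) F (x, y) =
      \int[m2]_(y in D2) (F (x, y) * ((phi y) `^ (-1))%:E * (phi y)%:E).
    apply: eq_integral => y /[!inE] Dy; rewrite -muleA -EFinM.
    by rewrite powR_inv1 ?phiE ?mule1// ltW// phi0.
  have -> : \int[m2]_(y in D2) H (x, y) = \int[m2]_(y in D2)
      ((F (x, y) * ((phi y) `^ (-1))%:E) `^ p * (phi y)%:E).
    apply: eq_integral => y /[!inE] Dy; rewrite poweRM ?lee_fin ?powR_ge0//.
    rewrite poweR_EFin -muleA -EFinM -powRrM mulN1r.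
    rewrite -[X in (_ * X)%R]powRr1 ?ltW ?phi0// -powRD; last first.
      by rewrite (gt_eqF (phi0 _ Dy)) implybT.
    by rewrite addrC.
  apply: jensen_poweR => //.
  - exact: measurable_funTS.
  - by move=> y Dy; rewrite mule_ge0// lee_fin powR_ge0.
  - by move=> y /phi0/ltW.
apply: (@le_trans _ _ (\int[m1]_(x in D1)
    ((c `^ (p - 1))%:E * \int[m2]_(y in D2) H (x, y)))).
  by apply: ge0_le_integral_nonmeasurable => // x _; exact: poweR_ge0.
rewrite integralZl_nonmeasurable ?powR_gt0//; last first.
  by move=> x _; exact: integral_ge0.
rewrite fubini_tonelli_in//.
have -> : (c `^ p = c `^ (p - 1) * c)%R.
  rewrite -[X in (_ * X)%R]powRr1 ?(ltW c0)// -powRD ?subrK//.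
  by rewrite (gt_eqF p0).
rewrite EFinM lee_pmul2l ?lte_fin ?powR_gt0// -phic.
apply: ge0_le_integral_nonmeasurable => y Dy; first exact: integral_ge0.
rewrite /H/=; under eq_integral do rewrite muleC.
rewrite integralZl_nonmeasurable ?powR_gt0 ?phi0//; last first.
  by move=> x _; exact: poweR_ge0.
have phiyE : (phi y = phi y `^ (1 - p) * phi y `^ p)%R.
  by rewrite -powRD ?subrK ?powRr1 ?oner_eq0// ltW// phi0.
rewrite [in leRHS]phiyE.
by rewrite EFinM lee_pmul2l ?Fphi// lte_fin powR_gt0// phi0.
Qed.

End minkowski.

(** * Substitution for restricted and rescaled image measures *)

Section change_of_measure.
Local Open Scope ereal_scope.
Context {R : realType}.

Lemma ge0_integral_mrestr d (T : measurableType d)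
    (mu : {measure set T -> \bar R}) (P D : set T) (mP : measurable P)
    (f : T -> \bar R) : measurable D -> measurable_fun D f ->
  (forall x, D x -> 0 <= f x) ->
  \int[mrestr mu mP]_(x in D) f x = \int[mu]_(x in D `&` P) f x.
Proof.
move=> mD mf f0; have mPC : measurable (~` P) by exact: measurableC.
rewrite (ge0_negligible_integral mPC mD mf f0); last first.
  by rewrite /= /mrestr setICl measure0.
rewrite setDE setCK; apply: eq_measure_integral => A mA ADP.
by rewrite /= /mrestr setIidl// => x /ADP[].
Qed.

(** One rule for three substitutions: dilations of the line and of R^n, where [P] is the whole
    space, and the surface measure, which is n times the image of the punctured ball under
    [direction]. *)
Lemma ge0_integral_scaled_pushforward d1 d2 (T1 : measurableType d1)
    (T2 : measurableType d2) (m1 : {measure set T1 -> \bar R})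
    (m2 : {measure set T2 -> \bar R}) (phi : T1 -> T2) (k : R) (P : set T1)
    (D : set T2) (f : T2 -> \bar R) :
  measurable_fun setT phi -> measurable P -> (0 <= k)%R ->
  (forall A, measurable A -> m2 A = k%:E * m1 (P `&` phi @^-1` A)) ->
  measurable D -> measurable_fun D f -> (forall y, D y -> 0 <= f y) ->
  \int[m2]_(y in D) f y = k%:E * \int[m1]_(x in P `&` phi @^-1` D) f (phi x).
Proof.
move=> mphi mP k0 m2E mD mf f0.
pose push : {measure set T2 -> \bar R} :=
  measure_function_pushforward__canonical__measure_function_Measure
    (mrestr m1 mP) mphi.
pose scaled : {measure set T2 -> \bar R} := mscale (NngNum k0) push.
rewrite (eq_measure_integral scaled); last first.
  by move=> A mA _; rewrite m2E//= /scaled/= /mscale/= /pushforward /mrestr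
    setIC.
rewrite ge0_integral_mscale//; congr (_ * _).
rewrite (ge0_integral_pushforward mphi)//; last by move=> y /[!inE]; exact: f0.
have mphiD : measurable (phi @^-1` D).
  by rewrite -[X in measurable X]setTI; exact: (mphi).
rewrite ge0_integral_mrestr//= 1?setIC//.
- apply: (measurable_comp mD _ mf) => [_ [x Dx <-]//|].
  by apply: measurable_funTS; exact: (mphi).
- by move=> x; exact: f0.
Qed.

End change_of_measure.

(** * Dilations and power tails on the real line *)

Section lebesgue_real.
Local Open Scope ereal_scope.
Context {R : realType}.
Notation mu := (@lebesgue_measure R).

Lemma lebesgue_measure_scale (c : R) (A : set R) : (0 < c)%R -> measurable A ->
  mu A = c%:E * mu ( *%R c @^-1` A).
Proof.
move=> c0 mA.
have mc : measurable_fun setT ( *%R c : measurableTypeR R -> measurableTypeR R).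
  exact: mulrl_measurable.
pose push : {measure set (measurableTypeR R) -> \bar R} :=
  measure_function_pushforward__canonical__measure_function_Measure mu mc.
pose scaled : {measure set (measurableTypeR R) -> \bar R} :=
  mscale (NngNum (ltW c0)) push.
rewrite (@lebesgue_measure_unique _ scaled)// => _ [[a b] _ <-].
rewrite /scaled /= /mscale/= /pushforward.
rewrite (_ : _ @^-1` _ = `](a / c)%R, (b / c)%R]%classic); last first.
  by apply/seteqP; split => x /=;
    rewrite !in_itv/= ltr_pdivrMr// ler_pdivlMr// (mulrC x).
rewrite !lebesgue_measure_itv/= !lte_fin ltr_pM2r ?invr_gt0//.
case: ifPn => _; last by rewrite mule0.
by rewrite -!EFinB -EFinM; congr EFin; field; rewrite gt_eqF.
Qed.

Lemma ge0_integral_scale (c : R) (D : set R) (f : R -> \bar R) : (0 < c)%R ->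
  measurable D -> measurable_fun D f -> (forall x, D x -> 0 <= f x) ->
  \int[mu]_(x in D) f x = c%:E * \int[mu]_(x in *%R c @^-1` D) f (c * x)%R.
Proof.
move=> c0 mD mf f0; rewrite -[in RHS](setTI (_ @^-1` D)).
apply: (@ge0_integral_scaled_pushforward R _ _ _ _ mu mu ( *%R c)) => //.
- exact: ltW.
- by move=> A mA; rewrite setTI -lebesgue_measure_scale.
Qed.

(** Writing the exponent as - 1 - b makes the value 1 / b at rho = 1; the factors 1 / a and 1 / b of
    both bounds come from here. *)
Lemma integral_powR_tail (b rho : R) : (0 < b)%R -> (0 < rho)%R ->
  \int[mu]_(s in `]rho, +oo[) (s `^ (- 1 - b))%:E = (rho `^ (- b) / b)%:E.
Proof.
move=> b0 rho0.
rewrite integral_itv_obnd_cbnd; last first.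
  by apply/measurable_EFinP/measurable_funTS; exact: measurable_powR.
pose F (x : R) := (- (x `^ (- b) / b))%R.
have dF (x : R) : (0 < x)%R -> is_derive x 1%R F (x `^ (- 1 - b))%R.
  move=> x0; rewrite /F (_ : (fun _ => _) = ((- b^-1) \*: (@powR R ^~ (-
    b)))%R); last first.
    by apply/funext => y /=; rewrite scaleNr mulrC.
  apply: is_derive_eq; first exact: is_deriveZ (is_derive1_powR _ x0).
  by rewrite /= /GRing.scale/= mulrA mulrNN mulVf ?gt_eqF// mul1r addrC.
have cF (x : R) : (0 < x)%R -> F y @[y --> x] --> F x.
  by move=> /dF[/derivable1_diffP/differentiable_continuous].
have dpow (x r : R) : (0 < x)%R -> {for x, continuous (@powR R ^~ r)}.
  move=> x0; have [] := is_derive1_powR r x0.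
  by move=> /derivable1_diffP/differentiable_continuous.
rewrite (@ge0_continuous_FTC2y _ _ F _ 0%R).
- by rewrite /F sub0e EFinN oppeK.
- by move=> x _; exact: powR_ge0.
- apply: continuous_in_subspaceT => x; rewrite inE/= in_itv/= andbT => rx.
  exact: dpow (lt_le_trans rho0 rx).
- apply/cvgrPdist_le => /= e e0; near=> x.
  have x0 : (0 < x)%R by near: x; exact: nbhs_pinfty_gt.
  rewrite sub0r /F opprK ger0_norm ?divr_ge0 ?powR_ge0 ?(ltW b0)//.
  rewrite ler_pdivrMr// powRN -[leRHS]invrK lef_pV2 ?posrE ?powR_gt0//;
    last first.
    by rewrite invr_gt0 mulr_gt0.
  have -> : ((e * b)^-1 = ((e * b)^-1 `^ b^-1) `^ b)%R.
    by rewrite -powRrM mulVf ?gt_eqF// powRr1// invr_ge0 mulr_ge0 ?(ltW e0)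
      ?(ltW b0).
  rewrite ge0_ler_powR ?nnegrE ?powR_ge0 ?(ltW b0) ?(ltW x0)//.
- by move=> x rx; have := dF x (lt_trans rho0 rx); case.
- exact/cvg_at_right_filter/cF.
- move=> x; rewrite in_itv/= andbT => rx.
  by rewrite derive1E; apply: derive_val; exact: dF (lt_trans rho0 rx).
Unshelve. all: by end_near. Qed.

End lebesgue_real.

(** * Dilations of Lebesgue measure *)

Section dilation.
Context {R : realType}.
Implicit Types n : nat.

Lemma enorm_ge0 n (x : Rn R n) : 0 <= enorm x.
Proof. exact: sqrtr_ge0. Qed.

Lemma enorm_tscale n (c : R) (x : Rn R n) : enorm (tscale c x) = `|c| * enorm x.
Proof.
rewrite /enorm; under eq_bigr do rewrite tnth_mktuple exprMn.
by rewrite -mulr_sumr sqrtrM ?sqr_ge0// sqrtr_sqr.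
Qed.

Lemma tnth_le_enorm n (x : Rn R n) i : `|tnth x i| <= enorm x.
Proof.
rewrite -sqrtr_sqr /enorm ler_sqrt ?sumr_ge0// => [|j _]; last exact: sqr_ge0.
by rewrite (bigD1 i)//= lerDl sumr_ge0// => j _; exact: sqr_ge0.
Qed.

Lemma tscaleA n (a b : R) (x : Rn R n) : tscale a (tscale b x) = tscale (a *
  b) x.
Proof. by apply: eq_from_tnth => i; rewrite !tnth_mktuple mulrA. Qed.

Lemma tscale1 n (x : Rn R n) : tscale 1 x = x.
Proof. by apply: eq_from_tnth => i; rewrite !tnth_mktuple mul1r. Qed.

Lemma enorm_direction n (x : Rn R n) : 0 < enorm x -> enorm (direction x) = 1.
Proof.
move=> x0; rewrite /direction enorm_tscale ger0_norm ?invr_ge0 ?enorm_ge0//.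
by rewrite mulVf// gt_eqF.
Qed.

Lemma measurable_preimage_enorm n (A : set R) : measurable A ->
  measurable (@enorm R n @^-1` A).
Proof. by rewrite -[X in _ -> measurable X]setTI => mA;
  exact: measurable_enorm. Qed.

Lemma tcons_tscale n (c : R) (z : R * Rn R n) :
  tcons (c * z.1, tscale c z.2) = tscale c (tcons z).
Proof.
apply: eq_from_tnth => i; rewrite tnth_mktuple /tcons.
by have [j ->|->] := unliftP ord0 i; rewrite ?tnthS ?tnth0 ?tnth_mktuple.
Qed.

Lemma measurable_fun_tscale n :
  measurable_fun [set: R * Rn R n] (fun z => tscale z.1 z.2).
Proof.
apply/measurable_fun_tnthP => i.
rewrite (_ : _ \o _ = fun z : R * Rn R n => z.1 * tnth z.2 i); last first.
  by apply/funext => z /=; rewrite tnth_mktuple.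
apply: measurable_funM; first exact: measurable_fst.
by apply: (measurableT_comp (measurable_tnth i)); exact: measurable_snd.
Qed.

Lemma measurable_tscale n (c : R) : measurable_fun [set: Rn R n] (tscale c).
Proof.
have -> : tscale c = (fun z : R * Rn R n => tscale z.1 z.2) \o (pair c) by [].
apply: measurableT_comp; first exact: measurable_fun_tscale.
exact: measurable_pair1.
Qed.

Local Open Scope ereal_scope.

(** By induction on the dimension: the rescaled image of the product measure under dilation of both
    factors agrees with it on rectangles, which determine it. *)
Lemma leb_tscale n (c : R) (A : set (Rn R n)) : (0 < c)%R -> measurable A ->
  leb R n A = (c ^+ n)%:E * leb R n (tscale c @^-1` A).
Proof.
move=> c0; elim: n A => [|n IH] A mA.
  rewrite expr0 mul1e /= !diracE.
  suff -> : (([tuple] : Rn R 0) \in tscale c @^-1` A) = (([tuple] : Rn R 0)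
    \in A) by [].
  by apply/idP/idP; rewrite !inE/= (tuple0 (tscale c _)).
pose g (z : measurableTypeR R * Rn R n) : measurableTypeR R * Rn R n := ((c *
  z.1)%R, tscale c z.2).
have mg : measurable_fun setT g.
  apply/measurable_fun_pair.
    by apply: measurable_funM; [exact: measurable_cst|exact: measurable_fst].
  by apply: (measurableT_comp (@measurable_tscale n c)); exact: measurable_snd.
pose push : {measure set (measurableTypeR R * Rn R n) -> \bar R} :=
  measure_function_pushforward__canonical__measure_function_Measure
    (@lebesgue_measure R \x leb R n) mg.
have cn0 : (0 <= c ^+ n.+1)%R by rewrite exprn_ge0// ltW.
pose scaled : {measure set (measurableTypeR R * Rn R n) -> \bar R} := mscale
  (NngNum cn0) push.
have mtA : measurable (@tcons R n @^-1` A).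
  by rewrite -[X in measurable X]setTI; exact: measurable_tcons.
transitivity (scaled (@tcons R n @^-1` A)).
  apply: (@product_measure_unique _ _ _ _ R (@lebesgue_measure R) (leb R n)
    scaled) => //.
  move=> B C mB mC; rewrite /scaled/= /mscale/= /pushforward.
  have -> : g @^-1` (B `*` C) = ( *%R c @^-1` B) `*` (tscale c @^-1` C) by [].
  have mcB : measurable ( *%R c @^-1` B).
    rewrite -[X in measurable X]setTI.
    by have := @mulrl_measurable R setT c; apply.
  have mcC : measurable (tscale c @^-1` C).
    by rewrite -[X in measurable X]setTI; exact: measurable_tscale.
  rewrite product_measure1E// (lebesgue_measure_scale c0 mB) (IH _ mC).
  by rewrite exprS EFinM muleACA.
have gE : g @^-1` (@tcons R n @^-1` A) = @tcons R n @^-1` (tscale c @^-1` A).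
  by apply/seteqP; split => z; rewrite /preimage/= -tcons_tscale.
by rewrite /scaled/= /mscale/= /pushforward gE.
Qed.

Lemma ge0_integral_tscale n (c : R) (D : set (Rn R n)) (f : Rn R n -> \bar R) :
  (0 < c)%R -> measurable D -> measurable_fun D f -> (forall x, D x -> 0 <= f
    x) ->
  \int[leb R n]_(x in D) f x =
  (c ^+ n)%:E * \int[leb R n]_(x in tscale c @^-1` D) f (tscale c x).
Proof.
move=> c0 mD mf f0; rewrite -[in RHS](setTI (_ @^-1` D)).
apply: (@ge0_integral_scaled_pushforward R _ _ _ _ (leb R n) (leb R n) (tscale
  c)) => //.
- exact: measurable_tscale.
- by rewrite exprn_ge0// ltW.
- by move=> A mA; rewrite setTI -leb_tscale.
Qed.

Lemma measurable_cube n : measurable [set x : Rn R n | forall i, (`|tnth x i|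
  <= 1)%R].
Proof.
rewrite (_ : [set x | _] = \bigcap_(i in [set: 'I_n])
    ((fun x : Rn R n => tnth x i) @^-1` `[(-1)%R, 1%R]%classic)).
  apply: fin_bigcap_measurable => // i _.
  by rewrite -[X in measurable X]setTI; exact: measurable_tnth.
apply/seteqP; split => x /= xP i; first by rewrite /= in_itv/= -ler_norml.
by have := xP i I; rewrite /= in_itv/= -ler_norml.
Qed.

(** A cube, unlike a ball, is a product, so its measure is accessible by induction; it contains the
    punctured ball, whose volume is therefore finite. *)
Lemma leb_cube_lty n : leb R n [set x | forall i, (`|tnth x i| <= 1)%R] < +oo.
Proof.
elim: n => [|n IH]; first by rewrite /= diracE; case: (_ \in _); rewrite ltry.
have -> : leb R n.+1 [set x | forall i, (`|tnth x i| <= 1)%R] =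
    (@lebesgue_measure R \x leb R n)
      (`[(-1)%R, 1%R]%classic `*` [set x | forall i, (`|tnth x i| <= 1)%R]).
  rewrite [LHS]/=/leb_step /pushforward; congr (_ _).
  apply/seteqP; split => -[a x] /=; rewrite in_itv/= -ler_norml.
    move=> xP; split => [|i]; first by have := xP ord0; rewrite /tcons tnth0.
    by have := xP (lift ord0 i); rewrite /tcons tnthS.
  move=> [aP xP] i.
  by have [j ->|->] := unliftP ord0 i; rewrite /tcons ?tnthS ?tnth0.
rewrite product_measure1E//; last exact: measurable_cube.
have I2 : @lebesgue_measure R `[(-1)%R, 1%R]%classic \is a fin_num.
  by rewrite lebesgue_measure_itv/=; case: ifP.
by rewrite lte_mul_pinfty.
Qed.

Lemma leb_punctured_ball_lty n : leb R n punctured_ball < +oo.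
Proof.
apply: le_lt_trans (leb_cube_lty n); apply: le_measure; rewrite ?inE.
- exact: measurable_punctured_ball.
- exact: measurable_cube.
- by move=> x /andP[_ x1] i; exact: le_trans (tnth_le_enorm x i) x1.
Qed.

Lemma leb_setT_gt0 n : 0 < leb R n setT.
Proof.
elim: n => [|n IH]; first by rewrite /= diracT lte01.
have -> : leb R n.+1 setT = (@lebesgue_measure R \x leb R n) (setT `*` setT).
  by rewrite setXTT.
have T0 : 0 < @lebesgue_measure R setT.
  by rewrite -set_itvNyy lebesgue_measure_itv/= lt0y.
by rewrite product_measure1E// mule_gt0.
Qed.

(** The set is invariant under dilation by 2, so its finite measure equals 2 ^ n times itself. *)
Lemma leb_enorm0 n : (0 < n)%N -> leb R n [set x | enorm x = 0%R] = 0.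
Proof.
move=> n0; set Z := [set x | _].
have mZ : measurable Z by exact: (measurable_preimage_enorm (measurable_set1
  0%R)).
have Zfin : leb R n Z \is a fin_num.
  rewrite ge0_fin_numE//; apply: le_lt_trans (leb_cube_lty n).
  apply: le_measure; rewrite ?inE//; first exact: measurable_cube.
  by move=> x /= x0 i; rewrite (le_trans (tnth_le_enorm x i))// x0.
have := @leb_tscale n 2%R Z (ltr0Sn _ _) mZ.
rewrite (_ : tscale 2 @^-1` Z = Z); last first.
  apply/seteqP; split => x /=; rewrite /Z/= enorm_tscale => /eqP.
    by rewrite mulf_eq0 normr_eq0 pnatr_eq0/= => /eqP.
  by move=> /eqP ->; rewrite mulr0.
rewrite -(fineK Zfin) -EFinM => -[/eqP].
rewrite -subr_eq0 -{1}[fine _]mul1r -mulrBl mulf_eq0 subr_eq0 =>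
  /orP[|/eqP->//].
by rewrite lt_eqF// exprn_egt1 ?ltr1n// -lt0n.
Qed.

(** Otherwise all dilates of the punctured ball would be null, but countably many of them and the
    origin cover the space. *)
Lemma leb_punctured_ball_gt0 n : (0 < n)%N -> 0 < leb R n punctured_ball.
Proof.
move=> n0; rewrite lt0e measure_ge0 andbT; apply/eqP => P0.
have := leb_setT_gt0 n; rewrite lt0e => /andP[/eqP + _]; apply.
pose S k := tscale (k.+1%:R^-1)%R @^-1` (@punctured_ball R n).
have mS k : measurable (S k).
  rewrite -[X in measurable X]setTI; apply: measurable_tscale => //.
  exact: measurable_punctured_ball.
have S0 k : leb R n (S k) = 0.
  have k0 : (0 < k.+1%:R^-1 :> R)%R by rewrite invr_gt0.
  have /eqP := leb_tscale k0 (@measurable_punctured_ball R n).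
  rewrite P0 eq_sym mule_eq0 eqe expf_eq0 n0/= gt_eqF//= => /eqP.
  by [].
apply: (measure_negligible measurableT).
apply: (@negligibleS _ _ _ _ ([set x | enorm x = 0%R] `|` \bigcup_k S k)).
  move=> x _; have [x0|x0] := eqVneq (enorm x) 0%R; [by left|right].
  have {}x0 : (0 < enorm x)%R by rewrite lt_neqAle eq_sym x0 enorm_ge0.
  exists (Num.truncn (enorm x)) => //;
    rewrite /S/= /punctured_ball/= enorm_tscale.
  rewrite ger0_norm ?invr_ge0// mulr_gt0 ?invr_gt0//= mulrC ler_pdivrMr// mul1r.
  exact/ltW/truncnS_gt.
apply: negligibleU.
  apply/negligibleP; last exact: leb_enorm0.
  exact: (measurable_preimage_enorm (measurable_set1 0%R)).
by apply: negligible_bigcup => k; apply/(negligibleP _ (mS k)); exact: S0.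
Qed.

End dilation.

(** * Polar coordinates *)

Section polar_coordinates.
Local Open Scope ereal_scope.
Context {R : realType} (n : nat).
Hypothesis n0 : (0 < n)%N.
Notation mu := (@lebesgue_measure R).
Notation N := (n%:R : R).
Let P := @punctured_ball R n.
Let S := @esphere R n.

Lemma measurable_esphere : measurable S.
Proof. exact: (measurable_preimage_enorm (measurable_set1 1%R)). Qed.

Lemma ge0_integral_sigma (h : Rn R n -> \bar R) :
  measurable_fun setT h -> (forall x, 0 <= h x) ->
  \int[sigma]_(t in S) h t = N%:E * \int[leb R n]_(x in P) h (direction x).
Proof.
move=> mh h0.
rewrite (@ge0_integral_scaled_pushforward R _ _ _ _ (leb R n) sigma direction
  N P)//.
- congr (_ * _); congr (integral _ _ _); rewrite setIidl// => x /andP[x0 _].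
  exact: enorm_direction.
- exact: measurable_direction.
- exact: measurable_punctured_ball.
- exact: measurable_esphere.
- exact: measurable_funTS.
Qed.

Lemma sigma_esphere : sigma S = N%:E * leb R n P.
Proof.
rewrite /sigma; congr (_ * leb R n _); rewrite setIidl// => x /andP[x0 _].
exact: enorm_direction.
Qed.

Variable g : Rn R n -> \bar R.
Hypotheses (mg : measurable_fun setT g) (g0 : forall x, 0 <= g x).

Let mpos : measurable (`]0%R, +oo[%classic : set R). Proof. by []. Qed.

Let ray (z : R * Rn R n) := g (tscale z.1 z.2).

Let mray : measurable_fun setT ray.
Proof. by apply: measurableT_comp => //; exact: measurable_fun_tscale. Qed.

Let msnd_direction :
  measurable_fun setT (fun z : R * Rn R n => (z.1, direction z.2)).
Proof.
apply/measurable_fun_pairP; split; first exact: measurable_fst.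
by apply: (measurableT_comp measurable_direction); exact: measurable_snd.
Qed.

Lemma measurable_fun_sphere_integral :
  measurable_fun setT (fun s : R => \int[sigma]_(t in S) g (tscale s t)).
Proof.
rewrite (_ : (fun _ => _) = (fun s => N%:E * 
    \int[leb R n]_(x in P) ray (s, direction x)));
    last first.
  apply/funext => s; rewrite ge0_integral_sigma//.
  by apply: measurableT_comp => //; exact: measurable_tscale.
apply: emeasurable_funM; first exact: measurable_cst.
apply: (@measurable_fun_integral2 _ _ _ _ _ (leb R n) P _
  (fun z : R * Rn R n => ray (z.1, direction z.2))) => [||z].
- exact: measurable_punctured_ball.
- exact: (measurableT_comp mray msnd_direction).
- exact: g0.
Qed.

(* [sigma] is [n] times the image of Lebesgue measure on the punctured ball [P].
   Substituting [s |x|] for [s], then [y] for [s x], and swapping the integrals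
   each time, the right-hand side becomes
   [n \int_y g(y) |y|^n (\int_{s >= |y|} s^(-1-n))], that is [\int_y g(y)]. *)
Lemma ge0_integral_polar :
  \int[leb R n]_x g x =
  \int[mu]_(s in `]0%R, +oo[)
    ((\int[sigma]_(t in S) g (tscale s t)) * (s `^ (N - 1))%:E).
Proof.
have N0 : (0 < N)%R by rewrite ltr0n.
have mP : measurable P := measurable_punctured_ball.
pose Y : set (Rn R n) := [set y | 0 < enorm y]%R.
have menorm2 : measurable_fun setT (fun z : R * Rn R n => enorm z.2).
  exact: (measurableT_comp measurable_enorm measurable_snd).
have mY : measurable Y.
  rewrite (_ : Y = enorm @^-1` `]0%R, +oo[).
    exact: measurable_preimage_enorm.
  by apply/seteqP; split => x /=; rewrite in_itv/= andbT.
pose f1 (z : R * Rn R n) := ray (z.1, direction z.2) * (z.1 `^ (N - 1))%:E.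
have mf1 : measurable_fun setT f1.
  apply: emeasurable_funM; last exact: measurable_EFin_powR measurable_fst.
  exact: (measurableT_comp mray msnd_direction).
have f10 z : 0 <= f1 z by rewrite mule_ge0 ?g0// lee_fin powR_ge0.
pose f2 (z : R * Rn R n) :=
  ray z * (z.1 `^ (N - 1))%:E * (enorm z.2 `^ N)%:E.
have mf2 : measurable_fun setT f2.
  apply: emeasurable_funM; last exact: measurable_EFin_powR menorm2.
  by apply: emeasurable_funM => //; exact: measurable_EFin_powR measurable_fst.
have f20 z : 0 <= f2 z by rewrite !mule_ge0 ?g0// lee_fin powR_ge0.
(* The test [enorm z.2 <= z.1] is the constraint |x| <= 1 of the punctured ball, read on y = s x. *)
pose f3 (z : R * Rn R n) := if (enorm z.2 <= z.1)%R then
  g z.2 * (enorm z.2 `^ N)%:E * (z.1 `^ (- 1 - N))%:E else 0.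
have mf3 : measurable_fun setT f3.
  apply: measurable_fun_ifT => //.
    apply: measurable_fun_ler; last exact: measurable_fst.
    exact: menorm2.
  apply: emeasurable_funM; last exact: measurable_EFin_powR measurable_fst.
  apply: emeasurable_funM; last exact: measurable_EFin_powR menorm2.
  by apply: (measurableT_comp mg); exact: measurable_snd.
have f30 z : 0 <= f3 z.
  by rewrite /f3; case: ifP => // _; rewrite !mule_ge0 ?g0// lee_fin powR_ge0.
transitivity (\int[leb R n]_(y in Y) g y).
  have mZ : measurable [set x : Rn R n | enorm x = 0%R].
    exact: (measurable_preimage_enorm (measurable_set1 0%R)).
  rewrite (ge0_negligible_integral mZ measurableT)//; last exact: leb_enorm0.
  congr (integral _ _ _); apply/seteqP; split => x /=; rewrite /Y/=.
    by move=> [_ /eqP xN0]; rewrite lt_neqAle eq_sym xN0 enorm_ge0.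
  by move=> x0; split => // xE; rewrite xE ltxx in x0.
transitivity (N%:E * \int[leb R n]_(y in Y) \int[mu]_(s in `]0%R, +oo[) f3 (s,
  y)).
  rewrite -integralZl_nonmeasurable//; last by move=> y _; exact: integral_ge0.
  apply: eq_integral => y /[!inE] y0.
  have -> : \int[mu]_(s in `]0%R, +oo[) f3 (s, y) =
      g y * (enorm y `^ N)%:E *
        \int[mu]_(s in `]enorm y, +oo[) (s `^ (- 1 - N))%:E.
    rewrite integral_itv_obnd_cbnd; last first.
      by apply/measurable_EFinP/measurable_funTS; exact: measurable_powR.
    rewrite -ge0_integralZl//; last 3 first.
    - by apply/measurable_EFinP/measurable_funTS; exact: measurable_powR.
    - by move=> s _; rewrite lee_fin powR_ge0.
    - by rewrite mule_ge0// lee_fin powR_ge0.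
    rewrite [LHS]integral_mkcond [RHS]integral_mkcond;
      apply: eq_integral => s _.
    rewrite /patch !mem_setE !in_itv/= !andbT /f3/=.
    have [ys|ys] := leP (enorm y) s; first by rewrite (lt_le_trans y0 ys).
    by case: ifP.
  rewrite integral_powR_tail// -muleA -EFinM muleCA -EFinM.
  have yN : (enorm y `^ N != 0)%R by rewrite gt_eqF// powR_gt0.
  rewrite (_ : (_ * _)%R = 1%R) ?mule1// powRN; field.
  by rewrite yN gt_eqF.
transitivity (N%:E * \int[mu]_(s in `]0%R, +oo[) \int[leb R n]_(x in P) f2 (s,
  x)).
  rewrite -(@fubini_tonelli_in _ _ _ _ _ mu (leb R n) _ Y)//.
  congr (_ * _); apply: eq_integral => s /[!inE]/=;
    rewrite in_itv/= andbT => s0.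
  rewrite [RHS](@ge0_integral_tscale _ _ s^-1%R) ?invr_gt0//; last first.
    exact/measurable_funTS/(measurableT_comp mf2)/measurable_pair1.
  have sN0 : (s != 0)%R by rewrite gt_eqF.
  rewrite -integralZl_nonmeasurable ?exprn_gt0 ?invr_gt0//.
  rewrite [LHS]integral_mkcond [RHS]integral_mkcond; apply: eq_integral => y _.
  have yP : (y \in tscale s^-1%R @^-1` P) = (y \in Y) && (enorm y <= s)%R.
    have PE : P (tscale s^-1%R y) = (0 < enorm y <= s)%R :> Prop.
      rewrite /P/= /punctured_ball/= enorm_tscale gtr0_norm ?invr_gt0//.
      by rewrite pmulr_rgt0 ?invr_gt0// mulrC ler_pdivrMr// mul1r.
    apply/idP/andP => [/set_mem/=|[/set_mem/= y0 ys]].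
      by rewrite PE => /andP[y0 ys]; rewrite inE.
    by apply/mem_set; rewrite /= PE; apply/andP.
  rewrite /patch yP; case: (boolP (y \in Y)) => //= /[!inE] yY.
  rewrite /f3/=; case: ifPn => // ys.
  rewrite /f2 /ray/= tscaleA mulfV// tscale1 enorm_tscale gtr0_norm ?invr_gt0//.
  rewrite muleCA -!muleA; congr (_ * _); rewrite -!EFinM; congr EFin.
  rewrite powRM ?invr_ge0 ?enorm_ge0 ?(ltW s0)//.
  have powD a b : (s `^ (a + b) = s `^ a * s `^ b)%R.
    by rewrite powRD// sN0 implybT.
  rewrite !powD !powRN powRr1 ?(ltW s0)// !powR_mulrn ?invr_ge0 ?enorm_ge0
    ?(ltW s0)// ?exprVn.
  by field; rewrite sN0 expf_neq0.
transitivity (N%:E * \int[mu]_(s in `]0%R, +oo[) \int[leb R n]_(x in P) f1 (s,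
  x)).
  rewrite (@fubini_tonelli_in _ _ _ _ _ mu (leb R n) _ _ mpos mP _ mf2 f20).
  rewrite (@fubini_tonelli_in _ _ _ _ _ mu (leb R n) _ _ mpos mP _ mf1 f10).
  apply: (congr1 (mule N%:E)); apply: eq_integral => x /set_mem /andP[x0 _].
  rewrite [RHS](@ge0_integral_scale _ (enorm x))//; last first.
    exact/measurable_funTS/(measurableT_comp mf1)/measurable_pair2.
  rewrite -integralZl_nonmeasurable//.
  rewrite (_ : _ @^-1` _ = `]0%R, +oo[%classic); last first.
    by apply/seteqP; split => s /=; rewrite !in_itv/= !andbT pmulr_rgt0.
  apply: eq_integral => s /[!inE]/=; rewrite in_itv/= andbT => s0.
  rewrite /f2 /f1 /ray/= /direction tscaleA mulrAC mulfV ?gt_eqF// mul1r.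
  rewrite [RHS]muleCA -muleA; congr (_ * _).
  rewrite -!EFinM powRM ?(ltW x0) ?(ltW s0)//; congr EFin.
  rewrite mulrC mulrA; congr (_ * _)%R.
  rewrite -[X in (X * _)%R]powRr1 ?ltW// -powRD;
    last by rewrite (gt_eqF x0) implybT.
  by rewrite addrC subrK.
rewrite -integralZl_nonmeasurable//; last by move=> s _; exact: integral_ge0.
apply: eq_integral => s /[!inE]/=; rewrite in_itv/= andbT => s0.
rewrite ge0_integral_sigma//; last first.
  by apply: measurableT_comp => //; exact: measurable_tscale.
rewrite /f1 -muleA; congr (_ * _).
under eq_integral do rewrite muleC.
rewrite /= integralZl_nonmeasurable ?powR_gt0// 1?muleC// => x _.
exact: g0.
Qed.

End polar_coordinates.

(** * Null sets and volumes of balls through polar coordinates *)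

Section null_sets.
Local Open Scope ereal_scope.
Context {R : realType} (n : nat).
Hypothesis n0 : (0 < n)%N.
Notation mu := (@lebesgue_measure R).
Notation N := (n%:R : R).
Let S := @esphere R n.

Lemma ge0_integral_polar_gt (h : Rn R n -> \bar R) (rho : R) : (0 <= rho)%R ->
  measurable_fun setT h -> (forall x, 0 <= h x) ->
  \int[leb R n]_(y in [set y | (rho < enorm y)%R]) h y =
  \int[mu]_(s in `]rho, +oo[)
    ((\int[sigma]_(t in S) h (tscale s t)) * (s `^ (N - 1))%:E).
Proof.
move=> rho0 mh h0; set A := [set y : Rn R n | (rho < enorm y)%R].
have mA : measurable A.
  rewrite (_ : A = enorm @^-1` `]rho, +oo[%classic).
    exact: measurable_preimage_enorm.
  by apply/seteqP; split => x /=; rewrite in_itv/= andbT.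
have mhA : measurable_fun setT (h \_ A).
  by apply/(measurable_restrictT _ _).1 => //; exact: measurable_funTS.
rewrite integral_mkcond ge0_integral_polar//; last first.
  by move=> x; exact: erestrict_ge0.
have -> : `]rho, +oo[%classic = `]0%R, +oo[ `&` `]rho, +oo[ :> set R.
  apply/seteqP; split => s /=; rewrite !in_itv/= !andbT; last by case.
  move=> rs.
  by split => //; exact: le_lt_trans rs.
rewrite integral_mkcondr; apply: eq_integral => s;
  rewrite mem_setE in_itv/= andbT => s0.
have sA t : S t -> (tscale s t \in A) = (rho < s)%R.
  move=> St; have -> : (tscale s t \in A) = (rho < enorm (tscale s t))%R.
    by apply/idP/idP => [/set_mem|/mem_set].
  by rewrite enorm_tscale St mulr1 gtr0_norm.
rewrite [RHS]/patch mem_setE in_itv/= andbT; case: ifPn => rs.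
  congr (_ * _); apply: eq_integral => t /set_mem St.
  by rewrite /patch sA// rs.
rewrite integral0_eq ?mul0e// => t St.
by rewrite /patch sA// (negbTE rs).
Qed.

(** Polar coordinates for the indicator of [M]: the radial integral vanishes, so almost every
    spherical slice has surface measure zero. *)
Lemma null_set_rays (M : set (Rn R n)) : measurable M -> leb R n M = 0 ->
  {ae mu, forall s : R, (0 < s)%R ->
    {ae sigma, forall t : Rn R n, S t -> ~ M (tscale s t)}}.
Proof.
move=> mM M0; pose h (x : Rn R n) : \bar R := (\1_M x)%:E.
have h0 x : 0 <= h x by rewrite lee_fin.
have mh : measurable_fun setT h.
  by apply/measurable_EFinP; exact: measurable_indic.
have mS : measurable S := @measurable_esphere R n.
have mhs s : measurable_fun setT (fun t : Rn R n => h (tscale s t)).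
  by apply: measurableT_comp => //; exact: measurable_tscale.
pose F s := (\int[sigma]_(t in S) h (tscale s t)) * (s `^ (N - 1))%:E.
have F0 s : 0 <= F s by rewrite mule_ge0 ?integral_ge0// lee_fin powR_ge0.
have mF : measurable_fun (`]0%R, +oo[%classic : set R) F.
  apply: measurable_funTS; apply: emeasurable_funM.
    exact: measurable_fun_sphere_integral.
  by apply/measurable_EFinP; exact: measurable_powR.
have IF : \int[mu]_(s in `]0%R, +oo[) `|F s| = 0.
  under eq_integral do rewrite gee0_abs//.
  by rewrite -ge0_integral_polar// integral_indic// setIT.
have /(ae_eq_integral_abs mu (measurable_itv _) mF) := IF.
apply: filterS => s /= Fs s0.
have {}Fs : F s = 0 by apply: Fs; rewrite in_itv/= andbT.
have : \int[sigma]_(t in S) `|h (tscale s t)| = 0.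
  under eq_integral do rewrite gee0_abs//.
  move/eqP : Fs; rewrite mule_eq0 => /orP[/eqP//|].
  by rewrite eqe powR_eq0 gt_eqF.
move/(ae_eq_integral_abs sigma mS (measurable_funTS (mhs s))).
apply: filterS => t /= ht St Mt; have := ht St.
by rewrite /h indicE mem_set// => -[] /eqP; rewrite oner_eq0.
Qed.

(** On almost every sphere [f] and [g] agree up to a null set. The slices of either function may be
    nonmeasurable, so only the comparisons for arbitrary nonnegative integrands apply. *)
Lemma ae_eq_local_norm (pt p alpha r : R) (f g : Rn R n -> \bar R) :
  {ae leb R n, forall x, f x = g x} ->
  local_norm pt p alpha r f = local_norm pt p alpha r g.
Proof.
move=> [M [mM M0 fgM]]; rewrite /local_norm; congr (_ `^ _).
apply: ge0_ae_eq_integral_nonmeasurable.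
- by move=> s _; rewrite mule_ge0 ?poweR_ge0// lee_fin powR_ge0.
- by move=> s _; rewrite mule_ge0 ?poweR_ge0// lee_fin powR_ge0.
apply: (@filterS _ _ (ae_filter_ringOfSetsType mu) _ _ _ (null_set_rays mM
  M0)) => s Ms /=; rewrite in_itv/= => /andP[s0 _].
congr (_ `^ _ * _); apply: ge0_ae_eq_integral_nonmeasurable => [t _|t _|].
- exact: poweR_ge0.
- exact: poweR_ge0.
apply: (@filterS _ _ (ae_filter_ringOfSetsType sigma) _ _ _ (Ms s0)) => t Mt
  St; congr (`|_| `^ _).
by apply: contrapT => fg; exact/(Mt St)/fgM.
Qed.

Lemma ae_eq_dual_hardy (f g : Rn R n -> \bar R) :
  {ae leb R n, forall x, f x = g x} -> dual_hardy f = dual_hardy g.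
Proof.
move=> fg; apply/funext => x; apply: ae_eq_integral_nonmeasurable.
by apply: filterS fg => y -> _.
Qed.

(** In polar coordinates the indicator of the sphere lives on the single radius 1. *)
Lemma leb_esphere : leb R n S = 0.
Proof.
have mS : measurable S := @measurable_esphere R n.
pose h (x : Rn R n) : \bar R := (\1_S x)%:E.
have h0 x : 0 <= h x by rewrite lee_fin.
have mh : measurable_fun setT h.
  by apply/measurable_EFinP; exact: measurable_indic.
rewrite -[S]setIT -(integral_indic (leb R n) measurableT)//.
rewrite (ge0_integral_polar n0 mh h0).
rewrite (@ge0_negligible_integral _ _ _ mu _ [set 1%R])//.
- apply: integral0_eq => s /= [+ /eqP s1]; rewrite in_itv/= andbT => s0.
  rewrite integral0_eq ?mul0e// => t St; rewrite /h indicE memNset//.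
  rewrite /S /esphere/= enorm_tscale St mulr1 gtr0_norm//.
  exact/eqP.
- apply: measurable_funTS; apply: emeasurable_funM.
    exact: measurable_fun_sphere_integral.
  by apply/measurable_EFinP; exact: measurable_powR.
- move=> s _; rewrite mule_ge0 ?lee_fin ?powR_ge0//.
  by apply: integral_ge0 => t _; exact: h0.
- by rewrite /= lebesgue_measure_set1.
Qed.

(** The kernel of H* uses open balls, the surface measure the punctured closed ball. Adding the unit
    sphere to one and the origin to the other, both null, gives the same set. *)
Lemma leb_eball (r : R) : (0 < r)%R ->
  leb R n (eball r) = (r ^+ n)%:E * leb R n punctured_ball.
Proof.
move=> r0.
have meball (c : R) : measurable (eball c : set (Rn R n)).
  rewrite (_ : eball c = enorm @^-1` `]-oo, c[%classic).
    exact: measurable_preimage_enorm.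
  by apply/seteqP; split => x /=; rewrite in_itv.
rewrite (leb_tscale r0 (meball r)); congr (_ * _).
have -> : tscale r @^-1` eball r = eball 1%R :> set (Rn R n).
  apply/funext => x; rewrite /eball/= enorm_tscale gtr0_norm//.
  by rewrite -[X in (_ < X)%R]mulr1 ltr_pM2l.
have mZ : measurable [set x : Rn R n | enorm x = 0%R].
  exact: (measurable_preimage_enorm (measurable_set1 0%R)).
rewrite -(@measureU0 _ _ _ (leb R n) (eball 1%R) S)//; last 2 first.
- exact: measurable_esphere.
- exact: leb_esphere.
rewrite -[RHS](@measureU0 _ _ _ (leb R n) _ [set x : Rn R n | enorm x = 0%R])//;
  last 2 first.
- exact: measurable_punctured_ball.
- exact: leb_enorm0.
congr (leb R n _); apply/seteqP; split => x.
  rewrite /S /eball /esphere /punctured_ball/= => x1.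
  have [x0|x0] := eqVneq (enorm x) 0%R; [by right|left].
  rewrite lt_neqAle eq_sym x0 enorm_ge0/=.
  by case: x1 => [/ltW//|->].
rewrite /S /eball /esphere /punctured_ball/= => -[/andP[_]|->]; last by left.
by rewrite le_eqVlt => /orP[/eqP|]; [right|left].
Qed.

End null_sets.

(** * Norms on the half-line *)

Section monotone_measurable.
Context {R : realType}.
Local Open Scope ereal_scope.

(** Measurability in the radius comes from monotonicity: local norms increase with r, tail integrals
    decrease. *)
Lemma nondecreasing_emeasurable (f : R -> \bar R) :
  {homo f : x y / (x <= y)%R >-> x <= y} -> measurable_fun setT f.
Proof.
move=> fnd; apply: (measurability _ (ErealGenCInfty.measurableE R)) => _ [_ [x
  ->] <-].
rewrite setTI; apply: is_interval_measurable => s t /=.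
rewrite !in_itv/= !andbT => xs xt u /andP[su ut].
by rewrite in_itv/= andbT (le_trans xs)// fnd.
Qed.

Lemma nonincreasing_emeasurable (f : R -> \bar R) :
  {homo f : x y / (x <= y)%R >-> y <= x} -> measurable_fun setT f.
Proof.
move=> fni; rewrite (_ : f = fun x => - - f x); last first.
  by apply/funext => x; rewrite oppeK.
apply: measurableT_comp => //; apply: nondecreasing_emeasurable => x y xy.
by rewrite leeN2 fni.
Qed.

End monotone_measurable.

(** * The one-dimensional dual Hardy operator in weighted norms on (0, r) *)

Section radial.
Context {R : realType}.
Local Open Scope ereal_scope.
Notation mu := (@lebesgue_measure R).

(** The local norm with the angular norm at radius s abstracted into [G s]; [local_normE] identifies
    the two for beta = n - 1 + alpha. *)
Definition radial_norm (pt beta : R) (G : R -> \bar R) (r : R) : \bar R :=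
  (\int[mu]_(s in `]0%R, r[) (G s `^ pt * (s `^ beta)%:E)) `^ pt^-1.

Lemma radial_norm_ge0 pt beta G r : 0 <= radial_norm pt beta G r.
Proof. exact: poweR_ge0. Qed.

Lemma radial_norm_nd pt beta G : (0 < pt)%R ->
  {homo radial_norm pt beta G : x y / (x <= y)%R >-> x <= y}.
Proof.
move=> pt0 x y xy; apply: gt0_ler_poweR; rewrite ?invr_ge0 ?(ltW pt0)//.
- rewrite in_itv/= leey andbT; apply: integral_ge0 => s _.
  by rewrite mule_ge0 ?poweR_ge0// lee_fin powR_ge0.
- rewrite in_itv/= leey andbT; apply: integral_ge0 => s _.
  by rewrite mule_ge0 ?poweR_ge0// lee_fin powR_ge0.
rewrite [leLHS]integral_mkcond [leRHS]integral_mkcond;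
  apply: ge0_le_integral_nonmeasurable => s _.
  by apply: erestrict_ge0 => u _;
    rewrite mule_ge0 ?poweR_ge0// lee_fin powR_ge0.
rewrite /patch !mem_setE !in_itv/=; case: ifPn => [/andP[-> sx]/=|_].
  by rewrite (lt_le_trans sx xy).
by case: ifPn => // _; rewrite mule_ge0 ?poweR_ge0// lee_fin powR_ge0.
Qed.

Lemma measurable_fun_mulT (L : R -> \bar R) : measurable_fun setT L ->
  measurable_fun setT (fun z : R * R => L (z.1 * z.2)%R).
Proof.
move=> mL; apply: (measurableT_comp mL).
by apply: measurable_funM; [exact: measurable_fst|exact: measurable_snd].
Qed.

Let ge0_integral_scale_itv (c r : R) (f : R -> \bar R) : (0 < c)%R ->
  measurable_fun setT f -> (forall x, 0 <= f x) ->
  \int[mu]_(x in `]0%R, (c * r)%R[) f x =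
  c%:E * \int[mu]_(x in `]0%R, r[) f (c * x)%R.
Proof.
move=> c0 mf f0; rewrite (ge0_integral_scale c0)//;
  last exact: measurable_funTS.
congr (_ * integral _ _ _); apply/seteqP; split => x /=;
  by rewrite !in_itv/= pmulr_rgt0// ltr_pM2l.
Qed.

Let ge0_integral_scale_itvy (c r : R) (f : R -> \bar R) : (0 < c)%R ->
  measurable_fun setT f -> (forall x, 0 <= f x) ->
  \int[mu]_(x in `](c * r)%R, +oo[) f x =
  c%:E * \int[mu]_(x in `]r, +oo[) f (c * x)%R.
Proof.
move=> c0 mf f0; rewrite (ge0_integral_scale c0)//;
  last exact: measurable_funTS.
congr (_ * integral _ _ _); apply/seteqP; split => x /=;
  by rewrite !in_itv/= !andbT ltr_pM2l.
Qed.

(** The substitution s = t rho turns the tail integral into an integral of the dilates G(t rho)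
    against dt / t over t > 1. Minkowski moves the norm inside, and the norm of G(t .) on (0, r) is
    t ^ (- (beta + 1) / pt) times that of G on (0, t r). *)
Lemma radial_dual_hardy (pt beta : R) (G : R -> \bar R) (r : R) :
  (1 <= pt)%R -> (0 < beta + 1)%R -> (0 < r)%R ->
  measurable_fun setT G -> (forall s, 0 <= G s) ->
  (forall s, radial_norm pt beta G s < +oo) ->
  radial_norm pt beta
    (fun rho => \int[mu]_(s in `]rho, +oo[) (G s * (s `^ (-1))%:E)) r <=
  \int[mu]_(t in `]1%R, +oo[)
    ((t `^ (- 1 - (beta + 1) / pt))%:E * radial_norm pt beta G (t * r)%R).
Proof.
move=> pt1 beta0 r0 mG G0 Lfin; have pt0 : (0 < pt)%R by exact: lt_le_trans pt1.
set L := radial_norm pt beta G; set d := ((beta + 1) / pt)%R.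
have d0 : (0 < d)%R by rewrite divr_gt0.
have L0 s : 0 <= L s by exact: radial_norm_ge0.
have mL : measurable_fun setT L by apply: nondecreasing_emeasurable;
  exact: radial_norm_nd.
have mLr : measurable_fun setT (fun t : R => L (t * r)%R).
  by apply: (measurableT_comp mL); exact: mulrr_measurable.
have mpow e : measurable_fun setT (fun t : R => (t `^ e)%:E).
  by apply/measurable_EFinP; exact: measurable_powR.
set I := \int[mu]_(t in _) _.
have I0 : 0 <= I by apply: integral_ge0 => t _;
  rewrite mule_ge0// lee_fin powR_ge0.
have [->|] := eqVneq I +oo; first exact: leey.
rewrite -ltey => Ioo; have Ifin : I \is a fin_num by rewrite ge0_fin_numE.
(* The term e' keeps the majorant [phi] positive where the local norm vanishes; it adds e' / d = e
   to the integral. *)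
apply/lee_addgt0Pr => e e0; pose e' := (e * d)%R.
have e'0 : (0 < e')%R by rewrite mulr_gt0.
pose phi t := (t `^ (- 1 - d) * (fine (L (t * r)) + e'))%R.
have phiE t : (phi t)%:E = (t `^ (- 1 - d))%:E * L (t * r)%R + e'%:E * (t `^
  (- 1 - d))%:E.
  rewrite /phi mulrDr EFinD !EFinM fineK ?ge0_fin_numE//.
  by rewrite [in RHS](muleC e'%:E).
have mphi : measurable_fun setT phi.
  apply: measurable_funM; first exact: measurable_powR.
  by apply: measurable_funD => //; exact: measurableT_comp.
have Iphi : \int[mu]_(t in `]1%R, +oo[) (phi t)%:E = (fine I + e)%:E.
  under eq_integral do rewrite phiE.
  rewrite ge0_integralD//; last 4 first.
  - by move=> t _; rewrite mule_ge0// lee_fin powR_ge0.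
  - by apply: measurable_funTS; exact: emeasurable_funM (mpow _) mLr.
  - by move=> t _; rewrite mule_ge0 ?lee_fin ?powR_ge0 ?(ltW e'0).
  - by apply: measurable_funTS; apply: emeasurable_funM (mpow _);
    exact: measurable_cst.
  rewrite -/I integralZl_nonmeasurable//; last by move=> t _;
    rewrite lee_fin powR_ge0.
  rewrite integral_powR_tail// powR1 EFinD fineK// -EFinM.
  by congr (_ + _%:E); rewrite /e'; field; rewrite gt_eqF.
(* The weight s ^ beta enters the pt-th power as s ^ (beta / pt), so that Minkowski is applied with
   plain Lebesgue measure. *)
pose F (z : R * R) := G (z.1 * z.2)%R * (z.2 `^ (-1))%:E * (z.1 `^ (beta /
  pt))%:E.
have mF : measurable_fun setT F.
  apply: emeasurable_funM; last exact: measurable_EFin_powR measurable_fst.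
  apply: emeasurable_funM; last exact: measurable_EFin_powR measurable_snd.
  exact: measurable_fun_mulT.
have F0 z : 0 <= F z by rewrite /F !mule_ge0// lee_fin powR_ge0.
have c0 : (0 < fine I + e)%R by rewrite ltr_wpDl// fine_ge0.
have := @minkowski_integral _ _ _ _ _ mu mu `]0%R, r[ `]1%R, +oo[
  (measurable_itv _) (measurable_itv _) F phi pt _ mF F0 mphi _ pt1 c0 Iphi _.
have -> : \int[mu]_(x in `]0%R, r[) (\int[mu]_(y in `]1%R, +oo[) F (x, y)) `^
  pt =
    \int[mu]_(s in `]0%R, r[)
      ((\int[mu]_(u in `]s, +oo[) (G u * (u `^ (-1))%:E)) `^ pt * (s `^
        beta)%:E).
  apply: eq_integral => s; rewrite mem_setE in_itv/= => /andP[s0 _].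
  have mGV : measurable_fun setT (fun u : R => G u * (u `^ (-1))%:E).
    exact: emeasurable_funM.
  have GV0 u : 0 <= G u * (u `^ (-1))%:E by rewrite mule_ge0// lee_fin powR_ge0.
  have := @ge0_integral_scale_itvy s 1%R _ s0 mGV GV0.
  rewrite mulr1 => ->; rewrite -integralZl_nonmeasurable//.
  have -> : \int[mu]_(y in `]1%R, +oo[) F (s, y) = (s `^ (beta / pt))%:E *
      \int[mu]_(y in `]1%R, +oo[) (G (s * y)%R * (y `^ (-1))%:E).
    rewrite -integralZl_nonmeasurable ?powR_gt0//; last first.
      by move=> y _; rewrite mule_ge0// lee_fin powR_ge0.
    by apply: eq_integral => y _; rewrite /F/= muleC.
  rewrite poweRM ?lee_fin ?powR_ge0//; last first.
    by apply: integral_ge0 => y _; rewrite mule_ge0// lee_fin powR_ge0.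
  rewrite poweR_EFin -powRrM divfK ?gt_eqF// muleC; congr (_ `^ _ * _).
  apply: eq_integral => y; rewrite mem_setE in_itv/= andbT => y1.
  rewrite muleCA; congr (_ * _); rewrite -EFinM; congr EFin.
  rewrite powRM ?(ltW s0) ?(ltW (lt_trans ltr01 y1))// (powR_inv1 (ltW s0)).
  by rewrite mulVKf// gt_eqF.
move=> H.
apply: (@le_trans _ _ (((fine I + e) `^ pt)%:E `^ pt^-1)).
  apply: gt0_ler_poweR; rewrite ?invr_ge0 ?(ltW pt0)//.
  - rewrite in_itv/= leey andbT; apply: integral_ge0 => s _.
    by rewrite mule_ge0 ?poweR_ge0// lee_fin powR_ge0.
  - by rewrite in_itv/= leey andbT lee_fin powR_ge0.
  apply: H.
    move=> t; rewrite /= in_itv/= andbT => t1.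
    have t0 : (0 < t)%R by exact: lt_trans t1.
    by rewrite /phi mulr_gt0 ?powR_gt0// ltr_wpDl ?fine_ge0.
  move=> t; rewrite /= in_itv/= andbT => t1.
  have t0 : (0 < t)%R by exact: lt_trans t1.
  have mGp : measurable_fun setT (fun u : R => G u `^ pt * (u `^ beta)%:E).
    by apply: emeasurable_funM => //;
      exact: measurableT_comp (measurable_poweR pt) mG.
  have Gp0 u : 0 <= G u `^ pt * (u `^ beta)%:E.
    by rewrite mule_ge0 ?poweR_ge0// lee_fin powR_ge0.
  have LE : L (t * r)%R `^ pt = t%:E *
      \int[mu]_(x in `]0%R, r[) (G (t * x)%R `^ pt * ((t * x) `^ beta)%:E).
    rewrite /L /radial_norm -poweRrM mulVf ?gt_eqF// poweRe1; last first.
      exact: integral_ge0.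
    exact: ge0_integral_scale_itv.
  apply: (@le_trans _ _ (((t `^ (- 1 - d))%:E * L (t * r)%R) `^ pt));
    last first.
    rewrite -[leRHS]poweR_EFin; apply: gt0_ler_poweR; rewrite ?(ltW pt0)//.
    - by rewrite in_itv/= leey andbT mule_ge0// lee_fin powR_ge0.
    - rewrite in_itv/= leey andbT lee_fin mulr_ge0 ?powR_ge0//.
      by rewrite addr_ge0 ?fine_ge0 ?(ltW e'0).
    by rewrite phiE leeDl// mule_ge0 ?lee_fin ?powR_ge0 ?(ltW e'0).
  rewrite poweRM ?lee_fin ?powR_ge0// LE poweR_EFin -powRrM muleA -EFinM.
  rewrite -integralZl_nonmeasurable ?mulr_gt0 ?powR_gt0//.
  rewrite le_eqVlt; apply/orP; left; apply/eqP; apply: eq_integral => x.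
  rewrite mem_setE in_itv/= => /andP[x0 xr].
  rewrite /F/= !poweRM ?mule_ge0 ?lee_fin ?powR_ge0// !poweR_EFin -!powRrM.
  rewrite divfK ?gt_eqF// [(x * t)%R]mulrC -muleA [RHS]muleCA; congr (_ * _).
  rewrite -!EFinM; congr EFin; rewrite powRM ?(ltW t0) ?(ltW x0)//.
  rewrite mulrA; congr (_ * _)%R.
  have tN0 : (t != 0)%R by rewrite gt_eqF.
  rewrite -{3}(powRr1 (ltW t0)) -!powRD ?tN0 ?implybT//; congr (_ `^ _)%R.
  by rewrite /d; field; rewrite gt_eqF.
rewrite poweR_EFin -powRrM mulfV ?gt_eqF// powRr1 ?(ltW c0)//.
by rewrite EFinD fineK.
Qed.

End radial.

(** * Morrey norms of functions of the radius *)

Section morrey.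
Context {R : realType}.
Local Open Scope ereal_scope.
Notation mu := (@lebesgue_measure R).

(** The outer part of [LML_norm], with the local norms abstracted into one function [L] of the
    radius. *)
Definition morrey_norm (lam : R) (q : \bar R) (L : R -> \bar R) : \bar R :=
  match q with
  | q'%:E =>
    (\int[mu]_(r in `]0%R, +oo[)
       (((r `^ (- lam))%:E * L r) `^ q' * (r^-1)%:E)) `^ q'^-1
  | +oo => ereal_sup [set (r `^ (- lam))%:E * L r | r in `]0%R, +oo[]
  | -oo => 0
  end.

Lemma morrey_integrand_ge0 (lam q r : R) (L : R -> \bar R) : (0 < r)%R ->
  0 <= ((r `^ (- lam))%:E * L r) `^ q * (r^-1)%:E.
Proof. by move=> r0; rewrite mule_ge0 ?poweR_ge0// lee_fin invr_ge0 ltW. Qed.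

Lemma le_morrey_norm (lam c : R) (q : \bar R) (L1 L2 : R -> \bar R) :
  1 <= q -> (0 < c)%R -> (forall r, 0 <= L1 r) -> (forall r, 0 <= L2 r) ->
  (forall r, (0 < r)%R -> L1 r <= c%:E * L2 r) ->
  morrey_norm lam q L1 <= c%:E * morrey_norm lam q L2.
Proof.
case: q => [q| |//]; rewrite ?lee_fin => q1 c0 L10 L20 L12; last first.
  apply: ge_ereal_sup => _ [r /=] + <-; rewrite in_itv/= andbT => r0.
  rewrite (@le_trans _ _ (c%:E * ((r `^ (- lam))%:E * L2 r)))//.
    by rewrite muleCA lee_pmul2l ?lte_fin ?powR_gt0// L12.
  rewrite lee_pmul2l// ; apply: ereal_sup_ubound => /=; exists r => //=.
  by rewrite in_itv/= andbT.
have q0 : (0 < q)%R by exact: lt_le_trans q1.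
rewrite /morrey_norm.
have -> : c%:E = (c `^ q)%:E `^ q^-1.
  by rewrite poweR_EFin -powRrM mulfV ?gt_eqF// powRr1// ltW.
rewrite -(@poweRM _ (c `^ q)%:E _ q^-1) ?lee_fin ?powR_ge0//; last first.
  apply: integral_ge0 => r; rewrite /= in_itv/= andbT;
    exact: morrey_integrand_ge0.
rewrite -integralZl_nonmeasurable ?powR_gt0//; last first.
  move=> r; rewrite /= in_itv/= andbT; exact: morrey_integrand_ge0.
apply: gt0_ler_poweR; rewrite ?invr_ge0 ?(ltW q0)//.
- rewrite in_itv/= leey andbT; apply: integral_ge0 => r;
  rewrite /= in_itv/= andbT.
  exact: morrey_integrand_ge0.
- rewrite in_itv/= leey andbT; apply: integral_ge0 => r;
  rewrite /= in_itv/= andbT.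
  by move=> r0; rewrite mule_ge0 ?lee_fin ?powR_ge0//;
    exact: morrey_integrand_ge0.
apply: ge0_le_integral_nonmeasurable => r; rewrite /= in_itv/= andbT => r0.
  exact: morrey_integrand_ge0.
rewrite muleA lee_pmul2r ?lte_fin ?invr_gt0//.
rewrite -(poweR_EFin c q) -poweRM ?lee_fin ?(ltW c0)//; last first.
  by rewrite mule_ge0// lee_fin powR_ge0.
apply: gt0_ler_poweR; rewrite ?(ltW q0)//.
- by rewrite in_itv/= leey andbT mule_ge0// lee_fin powR_ge0.
- by rewrite in_itv/= leey andbT !mule_ge0// lee_fin ?powR_ge0// ltW.
by rewrite muleCA lee_pmul2l ?lte_fin ?powR_gt0// L12.
Qed.

(** An infinite value of [L] persists at all larger radii, and a unit interval of them already makes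
    the norm infinite. *)
Lemma morrey_norm_lty (lam : R) (q : \bar R) (L : R -> \bar R) (r : R) :
  1 <= q -> {homo L : x y / (x <= y)%R >-> x <= y} -> (forall s, 0 <= L s) ->
  morrey_norm lam q L < +oo -> L r < +oo.
Proof.
move=> q1 Lnd L0 Loo; rewrite ltey; apply/eqP => Lr.
(* [r] may be nonpositive, while the Morrey norm only sees positive radii. *)
pose r' := Num.max r 1%R.
have r'0 : (0 < r')%R by rewrite lt_max ltr01 orbT.
have Ly s : (r' <= s)%R -> L s = +oo.
  move=> rs; apply/eqP; rewrite -leye_eq -Lr; apply: Lnd.
  by apply: le_trans rs; rewrite le_max lexx.
move: q q1 Loo => [q| |//]; rewrite ?lee_fin => q1; last first.
  apply/negP; rewrite -leNgt leye_eq; apply/eqP/ereal_supy => /=.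
  exists r'; first by rewrite /= in_itv/= andbT.
  by rewrite Ly// gt0_muley// lte_fin powR_gt0.
have q0 : (0 < q)%R by exact: lt_le_trans q1.
apply/negP; rewrite -leNgt leye_eq; apply/eqP/eqy_poweR; rewrite ?invr_gt0//.
apply/eqP; rewrite -leye_eq.
have <- : \int[mu]_(x in `]r', (r' + 1)%R[) (cst +oo x) = +oo.
  rewrite integral_cst//= lebesgue_measure_itv/= lte_fin ltrDl ltr01.
  by rewrite -EFinB addrAC subrr add0r mule1.
rewrite [leLHS]integral_mkcond [leRHS]integral_mkcond;
  apply: ge0_le_integral_nonmeasurable => s _.
  by apply: erestrict_ge0 => u _; rewrite leey.
rewrite /patch !mem_setE !in_itv/= andbT; case: ifPn => [/andP[rs _]|_].
  have s0 : (0 < s)%R by exact: lt_trans rs.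
  rewrite s0 Ly ?(ltW rs)// gt0_muley ?lte_fin ?powR_gt0//.
  by rewrite poweRyr ?gt_eqF// gt0_mulye// lte_fin invr_gt0.
by case: ifPn => // s0; exact: morrey_integrand_ge0.
Qed.

Lemma morrey_norm_gt0 (lam : R) (q : \bar R) (L : R -> \bar R) (r0 : R) :
  1 <= q -> {homo L : x y / (x <= y)%R >-> x <= y} -> (forall s, 0 <= L s) ->
  (0 < r0)%R -> 0 < L r0 -> 0 < morrey_norm lam q L.
Proof.
move=> q1 Lnd L0 r00 Lr0.
move: q q1 => [q| |//]; rewrite ?lee_fin => q1; last first.
  apply: (@lt_le_trans _ _ ((r0 `^ (- lam))%:E * L r0)).
    by rewrite mule_gt0// lte_fin powR_gt0.
  by apply: ereal_sup_ubound; exists r0 => //=; rewrite in_itv/= andbT.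
apply: poweR_gt0; pose f s := ((s `^ (- lam))%:E * L s) `^ q * (s `^ (-1))%:E.
apply: (@lt_le_trans _ _ (\int[mu]_(s in `]r0, (r0 + 1)%R[) f s)); last first.
  rewrite [leLHS]integral_mkcond [leRHS]integral_mkcond;
    apply: ge0_le_integral_nonmeasurable => s _.
    apply: erestrict_ge0 => u _.
    by rewrite mule_ge0 ?poweR_ge0// lee_fin powR_ge0.
  rewrite /patch !mem_setE !in_itv/= andbT; case: ifPn => [/andP[rs _]|_].
    have s0 : (0 < s)%R by exact: lt_trans rs.
    by rewrite s0 /f powR_inv1// ltW.
  by case: ifPn => // s0; exact: morrey_integrand_ge0.
have I1 : 0 < mu `]r0, (r0 + 1)%R[%classic.
  by rewrite lebesgue_measure_itv/= lte_fin ltrDl ltr01 -EFinB lte_fin addrAC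
    subrr add0r.
apply: integral_gt0 => //.
- have mL := nondecreasing_emeasurable Lnd.
  apply: measurable_funTS; apply: emeasurable_funM.
    apply: (measurableT_comp (measurable_poweR _));
      apply: emeasurable_funM => //.
    by apply/measurable_EFinP; exact: measurable_powR.
  by apply/measurable_EFinP; exact: measurable_powR.
- move=> s; rewrite /= in_itv/= => /andP[rs _].
  have s0 : (0 < s)%R by exact: lt_trans rs.
  rewrite mule_gt0 ?lte_fin ?powR_gt0// poweR_gt0// mule_gt0 ?lte_fin
    ?powR_gt0//.
  by apply: lt_le_trans Lr0 _; apply: Lnd; exact: ltW.
Qed.

Lemma measurable_morrey_weight (lam : R) (L : R -> \bar R) :
  measurable_fun setT L ->
  measurable_fun setT (fun r : R => (r `^ (- lam))%:E * L r).
Proof.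
move=> mL; apply: emeasurable_funM => //.
by apply/measurable_EFinP; exact: measurable_powR.
Qed.

(** With h(r) = r ^ (- lam) * L(r), the factor t ^ (- lam) of the kernel is absorbed into h(t r).
    Since dr / r is dilation invariant, all dilates of h have the same norm, and the kernel t ^ (- 1
    - a) left over has integral 1 / a. *)
Lemma morrey_norm_average (lam a : R) (q : \bar R) (L : R -> \bar R) :
  1 <= q -> (0 < a)%R -> measurable_fun setT L -> (forall r, 0 <= L r) ->
  morrey_norm lam q L < +oo ->
  morrey_norm lam q (fun r => \int[mu]_(t in `]1%R, +oo[)
    ((t `^ (- 1 - (a + lam)))%:E * L (t * r)%R)) <=
  (a^-1)%:E * morrey_norm lam q L.
Proof.
move=> q1 a0 mL L0 Loo.
pose h r := (r `^ (- lam))%:E * L r.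
have h0 r : 0 <= h r by rewrite mule_ge0// lee_fin powR_ge0.
have mh : measurable_fun setT h := measurable_morrey_weight lam mL.
have hE (r : R) : (0 < r)%R -> (r `^ (- lam))%:E * \int[mu]_(t in `]1%R, +oo[)
    ((t `^ (- 1 - (a + lam)))%:E * L (t * r)%R) =
    \int[mu]_(t in `]1%R, +oo[) ((t `^ (- 1 - a))%:E * h (t * r)%R).
  move=> r0; rewrite -integralZl_nonmeasurable; last 2 first.
  - exact: powR_gt0.
  - by move=> t _; rewrite mule_ge0// lee_fin powR_ge0.
  apply: eq_integral => t; rewrite mem_setE in_itv/= andbT => t1.
  have t0 : (0 < t)%R by exact: lt_trans t1.
  have -> : (- 1 - (a + lam) = - 1 - a + - lam)%R by ring.
  rewrite powRD ?(gt_eqF t0) ?implybT// [in RHS]/h powRM ?(ltW t0) ?(ltW r0)//.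
  rewrite !muleA -!EFinM; apply: (congr1 (fun z => z%:E * L (t * r)%R)).
  by ring.
move: q q1 Loo => [q| |//]; rewrite ?lee_fin => q1 Loo; last first.
  apply: ge_ereal_sup => _ [r /=] + <-; rewrite in_itv/= andbT => r0.
  rewrite hE//.
  have M0 : 0 <= morrey_norm lam +oo L.
    apply: (@le_trans _ _ (h 1%R)) => //; apply: ereal_sup_ubound;
      exists 1%R => //=.
    by rewrite in_itv/= ltr01.
  have Mfin : morrey_norm lam +oo L \is a fin_num by rewrite ge0_fin_numE.
  apply: (@le_trans _ _ (\int[mu]_(t in `]1%R, +oo[)
      ((t `^ (- 1 - a))%:E * morrey_norm lam +oo L))).
    apply: ge0_le_integral_nonmeasurable => t;
      first by rewrite mule_ge0// lee_fin powR_ge0.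
    rewrite /= in_itv/= andbT => t1.
    have t0 : (0 < t)%R by exact: lt_trans t1.
    rewrite lee_pmul2l ?lte_fin ?powR_gt0//; apply: ereal_sup_ubound.
    by exists (t * r)%R => //=; rewrite in_itv/= andbT mulr_gt0.
  rewrite ge0_integralZr//; last 2 first.
  - by apply/measurable_EFinP/measurable_funTS; exact: measurable_powR.
  - by move=> t _; rewrite lee_fin powR_ge0.
  by rewrite integral_powR_tail// powR1 mul1r.
have q0 : (0 < q)%R by exact: lt_le_trans q1.
set A := morrey_norm _ _ L.
have A0 : 0 <= A by exact: poweR_ge0.
have Afin : A \is a fin_num by rewrite ge0_fin_numE.
(* The summand e a makes [A'] positive even if [A] is 0, and becomes e after division by a. *)
apply/lee_addgt0Pr => e e0; pose A' := (fine A + e * a)%R.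
have A'0 : (0 < A')%R by rewrite ltr_wpDl ?fine_ge0// mulr_gt0.
pose phi (t : R) := (t `^ (- 1 - a) * A')%R.
have mphi : measurable_fun setT phi.
  by apply: measurable_funM => //; exact: measurable_powR.
have c0 : (0 < A' / a)%R by rewrite divr_gt0.
have Iphi : \int[mu]_(t in `]1%R, +oo[) (phi t)%:E = (A' / a)%:E.
  under eq_integral do rewrite /phi EFinM muleC.
  rewrite integralZl_nonmeasurable//; last by move=> t _;
    rewrite lee_fin powR_ge0.
  by rewrite integral_powR_tail// powR1 mul1r EFinM.
(* The factor r ^ (- 1 / q) carries the weight of dr / r inside the q-th power. *)
pose F (z : R * R) := h (z.1 * z.2)%R * (z.2 `^ (- 1 - a))%:E * (z.1 `^ (-
  q^-1))%:E.
have mF : measurable_fun setT F.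
  apply: emeasurable_funM; last exact: measurable_EFin_powR measurable_fst.
  apply: emeasurable_funM; last exact: measurable_EFin_powR measurable_snd.
  exact: measurable_fun_mulT.
have F0 z : 0 <= F z by rewrite /F !mule_ge0// lee_fin powR_ge0.
have powVq (r : R) : (0 < r)%R -> ((r `^ (- q^-1)) `^ q = r^-1)%R.
  by move=> r0; rewrite -powRrM mulNr mulVf ?gt_eqF// powR_inv1// ltW.
have := @minkowski_integral _ _ _ _ _ mu mu `]0%R, +oo[ `]1%R, +oo[
  (measurable_itv _) (measurable_itv _) F phi q _ mF F0 mphi _ q1 c0 Iphi _.
rewrite /morrey_norm.
have -> : \int[mu]_(x in `]0%R, +oo[) (\int[mu]_(y in `]1%R, +oo[) F (x, y))
  `^ q =
    \int[mu]_(r in `]0%R, +oo[) (((r `^ (- lam))%:E * \int[mu]_(t in `]1%R,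
      +oo[)
    ((t `^ (- 1 - (a + lam)))%:E * L (t * r)%R)) `^ q * (r^-1)%:E).
  apply: eq_integral => r; rewrite mem_setE in_itv/= andbT => r0; rewrite hE//.
  have -> : \int[mu]_(y in `]1%R, +oo[) F (r, y) = (r `^ (- q^-1))%:E *
      \int[mu]_(t in `]1%R, +oo[) ((t `^ (- 1 - a))%:E * h (t * r)%R).
    rewrite -integralZl_nonmeasurable ?powR_gt0//; last first.
      by move=> y _; rewrite mule_ge0// lee_fin powR_ge0.
    apply: eq_integral => y _; rewrite /F/= muleC; congr (_ * _).
    by rewrite muleC [(r * y)%R]mulrC.
  rewrite poweRM ?lee_fin ?powR_ge0//; last first.
    by apply: integral_ge0 => y _; rewrite mule_ge0// lee_fin powR_ge0.
  by rewrite poweR_EFin powVq// muleC.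
move=> H.
apply: (@le_trans _ _ (((A' / a) `^ q)%:E `^ q^-1)).
  apply: gt0_ler_poweR; rewrite ?invr_ge0 ?(ltW q0)//.
  - rewrite in_itv/= leey andbT; apply: integral_ge0 => r;
    rewrite /= in_itv/= andbT.
    exact: (@morrey_integrand_ge0 _ _ _ (fun r => _)).
  - by rewrite in_itv/= leey andbT lee_fin powR_ge0.
  apply: H => t; rewrite /= in_itv/= andbT => t1;
    have t0 : (0 < t)%R by exact: lt_trans t1.
    by rewrite /phi mulr_gt0// powR_gt0.
  have mhq : measurable_fun setT (fun r : R => h r `^ q * (r `^ (-1))%:E).
    apply: emeasurable_funM; first exact: measurableT_comp (measurable_poweR
      q) mh.
    by apply/measurable_EFinP; exact: measurable_powR.
  have hq0 r : 0 <= h r `^ q * (r `^ (-1))%:E.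
    by rewrite mule_ge0 ?poweR_ge0// lee_fin powR_ge0.
  have AE : A `^ q = t%:E * \int[mu]_(r in `]0%R, +oo[)
      (h (t * r)%R `^ q * ((t * r) `^ (-1))%:E).
    rewrite /A /morrey_norm -poweRrM mulVf ?gt_eqF// poweRe1; last first.
      apply: integral_ge0 => r; rewrite /= in_itv/= andbT.
      exact: morrey_integrand_ge0.
    transitivity (\int[mu]_(r in `]0%R, +oo[) (h r `^ q * (r `^ (-1))%:E)).
      apply: eq_integral => r; rewrite mem_setE in_itv/= andbT => r0.
      by rewrite powR_inv1// ltW.
    rewrite (ge0_integral_scale t0)//; last exact: measurable_funTS.
    congr (_ * integral _ _ _); apply/seteqP; split => r /=;
      by rewrite !in_itv/= !andbT pmulr_rgt0.
  apply: (@le_trans _ _ (((t `^ (- 1 - a))%:E * A) `^ q)); last first.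
    rewrite -[leRHS]poweR_EFin; apply: gt0_ler_poweR; rewrite ?(ltW q0)//.
    - by rewrite in_itv/= leey andbT mule_ge0// lee_fin powR_ge0.
    - by rewrite in_itv/= leey andbT lee_fin mulr_ge0 ?powR_ge0// ltW.
    rewrite /phi EFinM lee_pmul2l ?lte_fin ?powR_gt0// /A' EFinD fineK//.
    by rewrite leeDl// lee_fin mulr_ge0 ?(ltW e0) ?(ltW a0).
  rewrite poweRM ?lee_fin ?powR_ge0// AE poweR_EFin muleA -EFinM.
  rewrite -integralZl_nonmeasurable ?mulr_gt0 ?powR_gt0//.
  rewrite le_eqVlt; apply/orP; left; apply/eqP; apply: eq_integral => r.
  rewrite mem_setE in_itv/= andbT => r0.
  rewrite /F/= !poweRM ?mule_ge0 ?lee_fin ?powR_ge0// !poweR_EFin powVq//.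
  rewrite [(r * t)%R]mulrC -muleA [RHS]muleCA; congr (_ * _).
  rewrite -!EFinM; congr EFin;
    rewrite powR_inv1 ?mulr_ge0 ?(ltW t0) ?(ltW r0)//.
  by field; rewrite !gt_eqF.
rewrite poweR_EFin -powRrM mulfV ?gt_eqF// powRr1 ?(ltW c0)//.
rewrite /A' mulrDl mulfK ?gt_eqF// EFinD EFinM muleC fineK//.
Qed.

End morrey.

(** * The dual Hardy operator *)

Section upper_bound.
Context {R : realType} (n : nat).
Hypothesis n0 : (0 < n)%N.
Local Open Scope ereal_scope.
Notation mu := (@lebesgue_measure R).
Notation N := (n%:R : R).
Let S := @esphere R n.
Let V := fine (leb R n punctured_ball).

Let N0 : (0 < N)%R. Proof. by rewrite ltr0n. Qed.

Let VE : leb R n punctured_ball = V%:E.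
Proof. by rewrite fineK// ge0_fin_numE// leb_punctured_ball_lty. Qed.

Let V0 : (0 < V)%R.
Proof. by rewrite fine_gt0// leb_punctured_ball_lty leb_punctured_ball_gt0. Qed.

Let sigmaS : sigma S = (N * V)%:E.
Proof. by rewrite sigma_esphere VE. Qed.

Let mS : measurable S. Proof. exact: measurable_esphere. Qed.

Let mray (g : Rn R n -> \bar R) s : measurable_fun setT g ->
  measurable_fun setT (fun t => g (tscale s t)).
Proof. by move=> mg; apply: measurableT_comp => //;
  exact: measurable_tscale. Qed.

Lemma dual_hardyE (f : Rn R n -> \bar R) x : dual_hardy f x =
  \int[leb R n]_(y in [set y | (enorm x < enorm y)%R])
    (f y * (V^-1 * enorm y `^ (- N))%:E).
Proof.
apply: eq_integral => y /set_mem/= xy.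
have y0 : (0 < enorm y)%R by rewrite (le_lt_trans _ xy)// enorm_ge0.
rewrite leb_eball// VE -EFinM; congr (_ * _).
rewrite inver gt_eqF ?mulr_gt0 ?exprn_gt0//.
by rewrite powRN powR_mulrn ?(ltW y0)// invfM mulrC.
Qed.

Let measurable_kernel (f : Rn R n -> \bar R) : measurable_fun setT f ->
  measurable_fun setT (fun y => f y * (V^-1 * enorm y `^ (- N))%:E).
Proof.
move=> mf; apply: emeasurable_funM => //; apply/measurable_EFinP.
apply: measurable_funM => //.
apply: (@measurableT_comp _ _ _ _ _ _ (@powR R ^~ (- N)%R)) => //.
exact: measurable_enorm.
Qed.

(** H*f depends on x only through |x|, and the positive and negative parts of the integrand each
    give a nonincreasing function of |x|. *)
Lemma measurable_dual_hardy (f : Rn R n -> \bar R) :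
  measurable_fun setT (dual_hardy f).
Proof.
pose k y := f y * (V^-1 * enorm y `^ (- N))%:E.
pose T (h : Rn R n -> \bar R) (rho : R) :=
  \int[leb R n]_(y in [set y | (rho < enorm y)%R]) h y.
have mT h : (forall y, 0 <= h y) -> measurable_fun setT (fun x : Rn R n => T h
  (enorm x)).
  move=> h0; apply: (measurableT_comp _ measurable_enorm).
  apply: nonincreasing_emeasurable => s t st.
  rewrite /T [leLHS]integral_mkcond [leRHS]integral_mkcond;
    apply: ge0_le_integral_nonmeasurable => y _.
    exact: erestrict_ge0.
  rewrite /patch; case: ifPn => [/set_mem/= ty|_].
    by rewrite mem_set//=; exact: le_lt_trans ty.
  by case: ifPn.
rewrite (_ : dual_hardy f = fun x => T k^\+ (enorm x) - T k^\- (enorm x)).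
  by apply: emeasurable_funB; exact: mT.
by apply/funext => x; rewrite dual_hardyE integralE.
Qed.

(** The kernel s ^ (- n) / V meets the density s ^ (n - 1) of polar coordinates, whence ds / s. *)
Lemma ge0_dual_hardy_polar (h : Rn R n -> \bar R) x :
  measurable_fun setT h -> (forall y, 0 <= h y) ->
  dual_hardy h x = (V^-1)%:E * \int[mu]_(s in `]enorm x, +oo[)
    ((\int[sigma]_(t in S) h (tscale s t)) * (s `^ (-1))%:E).
Proof.
move=> mh h0; rewrite dual_hardyE (ge0_integral_polar_gt n0)//; last 3 first.
- exact: enorm_ge0.
- exact: measurable_kernel.
- by move=> y; rewrite mule_ge0// lee_fin mulr_ge0 ?powR_ge0// invr_ge0 ltW.
rewrite -integralZl_nonmeasurable ?invr_gt0//; last first.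
  by move=> s _; rewrite mule_ge0 ?lee_fin ?powR_ge0// integral_ge0.
apply: eq_integral => s; rewrite mem_setE in_itv/= andbT => xs.
have s0 : (0 < s)%R by rewrite (le_lt_trans _ xs)// enorm_ge0.
have -> : \int[sigma]_(t in esphere)
    (h (tscale s t) * (V^-1 * enorm (tscale s t) `^ (- N))%:E) =
    (V^-1 * s `^ (- N))%:E * \int[sigma]_(t in S) h (tscale s t).
  rewrite -integralZl_nonmeasurable; last 2 first.
  - by rewrite mulr_gt0 ?invr_gt0 ?powR_gt0.
  - by move=> t _; exact: h0.
  apply: eq_integral => t /set_mem St.
  by rewrite enorm_tscale St mulr1 gtr0_norm// muleC.
rewrite -muleA muleCA [RHS]muleCA; congr (_ * _).
rewrite -!EFinM; congr EFin; rewrite -mulrA -powRD ?(gt_eqF s0) ?implybT//.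
by congr (_ * _ `^ _)%R; ring.
Qed.

Lemma abse_dual_hardy_le (f : Rn R n -> \bar R) x : measurable_fun setT f ->
  `|dual_hardy f x| <= dual_hardy (fun y => `|f y|) x.
Proof.
move=> mf; rewrite !dual_hardyE.
set A := [set y | _].
have mA : measurable A.
  rewrite (_ : A = enorm @^-1` `]enorm x, +oo[%classic).
    exact: measurable_preimage_enorm.
  by apply/seteqP; split => y /=; rewrite in_itv/= andbT.
apply: le_trans (le_abse_integral _ mA _) _.
  by apply: measurable_funTS; exact: measurable_kernel.
rewrite le_eqVlt; apply/orP; left; apply/eqP; apply: eq_integral => y _.
by rewrite abseM abse_EFin ger0_norm// mulr_ge0 ?powR_ge0// invr_ge0 ltW.
Qed.

Definition angular_norm (p : R) (g : Rn R n -> \bar R) (s : R) : \bar R :=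
  (\int[sigma]_(t in S) (`|g (tscale s t)| `^ p)) `^ p^-1.

Lemma measurable_angular_norm p g : measurable_fun setT g ->
  measurable_fun setT (angular_norm p g).
Proof.
move=> mg; apply: (measurableT_comp (measurable_poweR _)).
apply: (@measurable_fun_sphere_integral R n (fun x => `|g x| `^ p)) => [|x].
  by apply: (measurableT_comp (measurable_poweR _)); exact: measurableT_comp.
exact: poweR_ge0.
Qed.

Lemma local_normE (pt p alpha r : R) (g : Rn R n -> \bar R) :
  local_norm pt p alpha r g =
  radial_norm pt (N - 1 + alpha) (angular_norm p g) r.
Proof.
rewrite /local_norm /radial_norm; congr (_ `^ _); apply: eq_integral => s _.
by rewrite /angular_norm -poweRrM mulrC.
Qed.

(** Jensen's inequality with weight 1 on the sphere, of total mass N V. *)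
Lemma angular_hoelder (p s : R) (g : Rn R n -> \bar R) : (1 <= p)%R ->
  measurable_fun setT g ->
  \int[sigma]_(t in S) `|g (tscale s t)| <=
    ((N * V) `^ (1 - p^-1))%:E * angular_norm p g s.
Proof.
move=> p1 mg; have p0 : (0 < p)%R by exact: lt_le_trans p1.
have NV0 : (0 < N * V)%R by rewrite mulr_gt0.
have mu_ : measurable_fun S (fun t => `|g (tscale s t)|).
  by apply/measurable_funTS/measurableT_comp => //; exact: mray.
have := @jensen_poweR R _ _ sigma S (fun t => `|g (tscale s t)|) (cst 1%R) p _
  mS mu_ (measurable_cst _) _ _ p1 NV0 _.
have -> : \int[sigma]_(x in S) (cst 1%R x)%:E = (N * V)%:E.
  transitivity (\int[sigma]_(x in S) (cst 1%:E x)); first by [].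
  by rewrite integral_cst// mul1e; exact: sigmaS.
under eq_integral do rewrite mule1.
under [in X in _ -> _ -> _ -> _ <= _ * X]eq_integral do rewrite mule1.
move=> /(_ (fun _ _ => abse_ge0 _) (fun _ _ => ler01) erefl) H.
have pN0 : p != 0%R by rewrite gt_eqF.
rewrite -[leLHS]poweRe1; last exact: integral_ge0.
rewrite -[X in _ `^ X](mulfV pN0) poweRrM /angular_norm.
have -> : ((N * V) `^ (1 - p^-1))%:E = ((N * V) `^ (p - 1))%:E `^ p^-1.
  by rewrite poweR_EFin -powRrM mulrBl mul1r mulfV// gt_eqF.
rewrite -poweRM; last 2 first.
- by rewrite lee_fin powR_ge0.
- by apply: integral_ge0 => t _; exact: poweR_ge0.
apply: gt0_ler_poweR => //; rewrite ?invr_ge0 ?(ltW p0)//.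
- by rewrite in_itv/= leey andbT poweR_ge0.
- rewrite in_itv/= leey andbT mule_ge0 ?lee_fin ?powR_ge0//.
  by apply: integral_ge0 => t _; exact: poweR_ge0.
Qed.

(** The pointwise bound has constant V^-1 * (N V) ^ (1 - 1 / p) and does not depend on the
    direction, so its angular norm gains (N V) ^ (1 / p). The volume [V] cancels and N remains. *)
Lemma local_norm_dual_hardy_le (pt p alpha r : R) (g : Rn R n -> \bar R) :
  (1 <= p)%R -> (1 <= pt)%R -> measurable_fun setT g ->
  local_norm pt p alpha r (dual_hardy g) <=
  N%:E * radial_norm pt (N - 1 + alpha) (fun s => \int[mu]_(u in `]s, +oo[)
    (angular_norm p g u * (u `^ (-1))%:E)) r.
Proof.
move=> p1 pt1 mg.
have p0 : (0 < p)%R by exact: lt_le_trans p1.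
have pt0 : (0 < pt)%R by exact: lt_le_trans pt1.
have NV0 : (0 < N * V)%R by rewrite mulr_gt0.
set K := fun s => _.
have K0 s : 0 <= K s.
  by apply: integral_ge0 => u _; rewrite mule_ge0 ?poweR_ge0// lee_fin powR_ge0.
pose c := (V^-1 * (N * V) `^ (1 - p^-1))%R.
have c0 : (0 < c)%R by rewrite mulr_gt0 ?invr_gt0 ?powR_gt0.
have HK s t : S t -> (0 < s)%R -> `|dual_hardy g (tscale s t)| <= c%:E * K s.
  move=> St s0; apply: (le_trans (abse_dual_hardy_le _ mg)).
  rewrite ge0_dual_hardy_polar//; last exact: measurableT_comp.
  rewrite enorm_tscale St mulr1 gtr0_norm// /c EFinM -muleA.
  rewrite lee_pmul2l ?lte_fin ?invr_gt0// -integralZl_nonmeasurable;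
    last 2 first.
  - by rewrite powR_gt0.
  - by move=> u _; rewrite mule_ge0 ?poweR_ge0// lee_fin powR_ge0.
  apply: ge0_le_integral_nonmeasurable => u _.
    by rewrite mule_ge0 ?integral_ge0// lee_fin powR_ge0.
  by rewrite muleA lee_wpmul2r ?lee_fin ?powR_ge0//; exact: angular_hoelder.
have inner s : (0 < s)%R ->
    \int[sigma]_(t in S) (`|dual_hardy g (tscale s t)| `^ p) <= (N%:E * K s)
      `^ p.
  move=> s0.
  have -> : (N%:E * K s) `^ p = \int[sigma]_(t in S) (cst ((c%:E * K s) `^ p)
    t).
    rewrite integral_cst//.
    transitivity ((c%:E * K s) `^ p * (N * V)%:E); last first.
      by apply: (congr1 (mule _)); exact/esym/sigmaS.
    rewrite !poweRM ?lee_fin ?(ltW c0) ?(ltW N0)// !poweR_EFin muleAC -EFinM.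
    congr (_%:E * _); rewrite /c (@powRM _ V^-1) ?invr_ge0 ?powR_ge0 ?(ltW
      V0)//.
    rewrite -powRrM mulrBl mul1r mulVf ?gt_eqF//.
    have Vp : ((V^-1) `^ p = (V `^ p)^-1)%R.
      by rewrite -(powR_inv1 (ltW V0)) -powRrM mulN1r powRN.
    have Np : ((N * V) `^ (p - 1) * (N * V) = N `^ p * V `^ p)%R.
      rewrite -{2}(powRr1 (ltW NV0)) -powRD ?subrK ?(gt_eqF p0)//.
      by rewrite powRM ?(ltW N0) ?(ltW V0).
    by rewrite Vp -mulrA Np; field; rewrite gt_eqF ?powR_gt0.
  apply: ge0_le_integral_nonmeasurable => t St; first exact: poweR_ge0.
  apply: gt0_ler_poweR; rewrite ?(ltW p0)//.
  - by rewrite in_itv/= leey andbT.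
  - by rewrite in_itv/= leey andbT mule_ge0// lee_fin ltW.
  exact: HK.
have -> : N%:E = (N `^ pt)%:E `^ pt^-1.
  by rewrite poweR_EFin -powRrM mulfV ?gt_eqF// powRr1// ltW.
rewrite /local_norm /radial_norm -poweRM; last 2 first.
- by rewrite lee_fin powR_ge0.
- by apply: integral_ge0 => s _; rewrite mule_ge0 ?poweR_ge0// lee_fin powR_ge0.
rewrite -integralZl_nonmeasurable; last 2 first.
- by rewrite powR_gt0.
- by move=> s _; rewrite mule_ge0 ?poweR_ge0// lee_fin powR_ge0.
apply: gt0_ler_poweR; rewrite ?invr_ge0 ?(ltW pt0)//.
- rewrite in_itv/= leey andbT; apply: integral_ge0 => s _.
  by rewrite mule_ge0 ?poweR_ge0// lee_fin powR_ge0.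
- rewrite in_itv/= leey andbT; apply: integral_ge0 => s _.
  by rewrite !mule_ge0 ?poweR_ge0// lee_fin powR_ge0.
apply: ge0_le_integral_nonmeasurable => s;
  first by rewrite mule_ge0 ?poweR_ge0// lee_fin powR_ge0.
rewrite /= in_itv/= => /andP[s0 _].
rewrite muleA lee_wpmul2r ?lee_fin ?powR_ge0//.
apply: (@le_trans _ _ (((N%:E * K s) `^ p) `^ (pt / p))).
  apply: gt0_ler_poweR; rewrite ?divr_ge0 ?(ltW pt0) ?(ltW p0)//.
  - rewrite in_itv/= leey andbT; apply: integral_ge0 => t _; exact: poweR_ge0.
  - by rewrite in_itv/= leey andbT poweR_ge0.
  exact: inner.
by rewrite -poweRrM mulrC divfK ?gt_eqF// poweRM ?lee_fin ?(ltW N0).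
Qed.

End upper_bound.

(** * The bound on the Morrey space and its sharpness *)

Section norm_of_dual_hardy.
Context {R : realType} (n : nat).
Hypothesis n0 : (0 < n)%N.
Local Open Scope ereal_scope.
Notation mu := (@lebesgue_measure R).
Notation N := (n%:R : R).
Variables (pt lam : R) (q : \bar R) (p alpha : R).
Hypotheses (p1 : (1 <= p)%R) (pt1 : (1 <= pt)%R) (q1 : 1 <= q).
Let a := ((N + alpha) / pt - lam)%R.
Hypotheses (a0 : (0 < a)%R) (lam0 : (0 <= lam)%R).

Let pt0 : (0 < pt)%R. Proof. exact: lt_le_trans pt1. Qed.
Let p0 : (0 < p)%R. Proof. exact: lt_le_trans p1. Qed.
Let N0 : (0 < N)%R. Proof. by rewrite ltr0n. Qed.

Let beta := (N - 1 + alpha)%R.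

(** The scaling exponent (n + alpha) / pt of the radial norm splits into lam, absorbed by the weight
    r ^ (- lam), and a, the decay left to the kernel. *)
Let beta1 : (beta + 1 = (a + lam) * pt)%R.
Proof. by rewrite /beta /a subrK divfK ?gt_eqF//; ring. Qed.

Lemma LML_normE (f : Rn R n -> \bar R) : LML_norm pt lam q p alpha f =
  morrey_norm lam q (fun r => local_norm pt p alpha r f).
Proof. by case: q. Qed.

Lemma ae_eq_LML_norm (f g : Rn R n -> \bar R) :
  {ae leb R n, forall x, f x = g x} ->
  LML_norm pt lam q p alpha f = LML_norm pt lam q p alpha g.
Proof.
move=> fg; rewrite !LML_normE; congr morrey_norm; apply/funext => r.
exact: ae_eq_local_norm.
Qed.

Lemma LML_norm_dual_hardy_le (f : Rn R n -> \bar R) : LML pt lam q p alpha f ->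
  LML_norm pt lam q p alpha (dual_hardy f) <=
  (N / a)%:E * LML_norm pt lam q p alpha f.
Proof.
(* From here on [f] is its Borel representative [g]. *)
move=> [[g mg fg]]; rewrite (ae_eq_LML_norm fg) (ae_eq_dual_hardy fg)
  !LML_normE.
pose L := radial_norm pt beta (angular_norm p g).
have -> : (fun r => local_norm pt p alpha r g) = L.
  by apply/funext => r; rewrite local_normE.
move=> Loo.
have L0 r : 0 <= L r by exact: radial_norm_ge0.
have Lnd : {homo L : x y / (x <= y)%R >-> x <= y} by exact: radial_norm_nd.
have mL : measurable_fun setT L by exact: nondecreasing_emeasurable.
have Lfin r : L r < +oo by exact: morrey_norm_lty Loo.
pose L2 r := \int[mu]_(t in `]1%R, +oo[)
  ((t `^ (- 1 - (a + lam)))%:E * L (t * r)%R).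
have L20 r : 0 <= L2 r.
  by apply: integral_ge0 => t _; rewrite mule_ge0// lee_fin powR_ge0.
apply: (@le_trans _ _ (N%:E * morrey_norm lam q L2)).
  apply: le_morrey_norm => // [r|r r0]; first exact: poweR_ge0.
  apply: (le_trans (local_norm_dual_hardy_le n0 alpha r p1 pt1 mg)).
  rewrite lee_pmul2l// /L2.
  have -> : (a + lam = (beta + 1) / pt)%R by rewrite beta1 mulfK ?gt_eqF.
  apply: radial_dual_hardy => //.
  - by rewrite beta1 mulr_gt0// ltr_wpDr.
  - exact: measurable_angular_norm.
  - by move=> s; exact: poweR_ge0.
rewrite EFinM -muleA lee_pmul2l//.
exact: morrey_norm_average.
Qed.

Lemma LML_dual_hardy (f : Rn R n -> \bar R) : LML pt lam q p alpha f ->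
  LML pt lam q p alpha (dual_hardy f).
Proof.
move=> Lf; split.
  exists (dual_hardy f); first exact: measurable_dual_hardy.
  exact: aeW.
apply: (le_lt_trans (LML_norm_dual_hardy_le Lf)).
by rewrite lte_mul_pinfty// ?lee_fin ?divr_ge0 ?(ltW N0) ?(ltW a0)//; case: Lf.
Qed.

Lemma le_local_norm (c r : R) (f1 f2 : Rn R n -> \bar R) : (0 < c)%R ->
  (forall x, `|f1 x| <= c%:E * `|f2 x|) ->
  local_norm pt p alpha r f1 <= c%:E * local_norm pt p alpha r f2.
Proof.
move=> c0 f12.
have cpow (z : R) : (0 < z)%R -> c%:E = (c `^ z)%:E `^ z^-1.
  by move=> z0; rewrite poweR_EFin -powRrM mulfV ?gt_eqF// powRr1// ltW.
have int0 s h : 0 <= \int[sigma]_(t in @esphere R n) (`|h (tscale s t)| `^ p).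
  by apply: integral_ge0 => t _; exact: poweR_ge0.
have outer0 h : 0 <= \int[mu]_(s in `]0%R, r[)
    ((\int[sigma]_(t in @esphere R n) (`|h (tscale s t)| `^ p)) `^ (pt / p) *
      (s `^ (N - 1 + alpha))%:E).
  by apply: integral_ge0 => s _; rewrite mule_ge0 ?poweR_ge0// lee_fin powR_ge0.
rewrite (cpow pt)// /local_norm -poweRM; last 2 first.
- by rewrite lee_fin powR_ge0.
- exact: outer0.
rewrite -integralZl_nonmeasurable; last 2 first.
- by rewrite powR_gt0.
- by move=> s _; rewrite mule_ge0 ?poweR_ge0// lee_fin powR_ge0.
apply: gt0_ler_poweR; rewrite ?invr_ge0 ?(ltW pt0)//.
- by rewrite in_itv/= leey andbT.
- rewrite in_itv/= leey andbT; apply: integral_ge0 => s _.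
  by rewrite !mule_ge0 ?poweR_ge0// lee_fin powR_ge0.
apply: ge0_le_integral_nonmeasurable => s _;
  first by rewrite mule_ge0 ?poweR_ge0// lee_fin powR_ge0.
rewrite muleA lee_wpmul2r ?lee_fin ?powR_ge0//.
have -> : (c `^ pt)%:E = (c `^ p)%:E `^ (pt / p).
  by rewrite poweR_EFin -powRrM mulrC divfK ?gt_eqF.
rewrite -poweRM ?lee_fin ?powR_ge0//.
apply: gt0_ler_poweR; rewrite ?divr_ge0 ?(ltW pt0) ?(ltW p0)//.
- by rewrite in_itv/= leey andbT.
- by rewrite in_itv/= leey andbT mule_ge0// lee_fin powR_ge0.
rewrite -integralZl_nonmeasurable; last 2 first.
- by rewrite powR_gt0.
- by move=> t _; exact: poweR_ge0.
apply: ge0_le_integral_nonmeasurable => t _; first exact: poweR_ge0.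
rewrite -(poweR_EFin c p) -poweRM ?lee_fin ?(ltW c0)//.
apply: gt0_ler_poweR; rewrite ?(ltW p0)//.
- by rewrite in_itv/= leey andbT.
- by rewrite in_itv/= leey andbT mule_ge0// lee_fin ltW.
Qed.

Section power_function.
(* The local norm on the ball of radius [r] of the truncated power of exponent
   [- b], where [b = a + e], grows at most like [r ^ m]. *)
Variables (e m : R).
(** The local norm is governed by the integral of s ^ ((lam - e) pt - 1) over (1, r), whose growth
    depends on the sign of lam - e. A nonnegative m above lam - e avoids the distinction, and m <=
    lam, strict for finite q, controls r ^ (m - lam) at infinity. *)
Hypotheses (e0 : (0 < e)%R) (m0 : (0 <= m)%R) (mlam : (m <= lam)%R).
Hypotheses (mq : q < +oo -> (m < lam)%R) (me : (lam - e < m)%R).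
Let b := (a + e)%R.
Let b0 : (0 < b)%R. Proof. by rewrite addr_gt0. Qed.

Definition radial_power (c : R) (x : Rn R n) : \bar R :=
  if (1 < enorm x)%R then (enorm x `^ (- c))%:E else 0.

Let f := radial_power b.

Let f0 x : 0 <= f x.
Proof. by rewrite /f /radial_power; case: ifP => // _;
  rewrite lee_fin powR_ge0. Qed.

Let mf : measurable_fun setT f.
Proof.
apply: measurable_fun_ifT => //.
  by apply: measurable_fun_ltr => //; exact: measurable_enorm.
apply/measurable_EFinP.
apply: (@measurableT_comp _ _ _ _ _ _ (@powR R ^~ (- b)%R)) => //.
exact: measurable_enorm.
Qed.

Let V := fine (leb R n punctured_ball).
Let VE : leb R n punctured_ball = V%:E.
Proof. by rewrite fineK// ge0_fin_numE// leb_punctured_ball_lty. Qed.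
Let V0 : (0 < V)%R.
Proof. by rewrite fine_gt0// leb_punctured_ball_lty leb_punctured_ball_gt0. Qed.

Let integral_sphere_cst (k : \bar R) :
  \int[sigma]_(t in @esphere R n) cst k t = k * (N * V)%:E.
Proof.
rewrite integral_cst; last exact: measurable_esphere.
apply: (congr1 (mule k)); rewrite EFinM -VE.
exact: sigma_esphere.
Qed.

Let fray s t : esphere t -> (1 < s)%R -> f (tscale s t) = (s `^ (- b))%:E.
Proof.
move=> St s1; rewrite /f /radial_power enorm_tscale St mulr1 gtr0_norm ?s1//.
exact: lt_trans s1.
Qed.

(** An equality for |x| > 1, where the truncation is invisible to H*; elsewhere the left-hand side
    is 0. *)
Lemma le_dual_hardy_radial_power x : (N / b)%:E * f x <= dual_hardy f x.
Proof.
rewrite (ge0_dual_hardy_polar n0 x mf f0) {1}/f /radial_power.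
have J0 s : 0 <= (\int[sigma]_(t in esphere) f (tscale s t)) * (s `^ (-1))%:E.
  by rewrite mule_ge0 ?lee_fin ?powR_ge0// integral_ge0.
case: ifPn => x1; last first.
  by rewrite mule0 mule_ge0 ?lee_fin ?invr_ge0 ?(ltW V0)// integral_ge0.
have x0 : (0 < enorm x)%R by exact: lt_trans x1.
have -> : \int[mu]_(s in `]enorm x, +oo[)
    ((\int[sigma]_(t in esphere) f (tscale s t)) * (s `^ (-1))%:E) =
    (N * V)%:E * \int[mu]_(s in `]enorm x, +oo[) (s `^ (- 1 - b))%:E.
  rewrite -integralZl_nonmeasurable; last 2 first.
  - by rewrite mulr_gt0.
  - by move=> s _; rewrite lee_fin powR_ge0.
  apply: eq_integral => s; rewrite mem_setE in_itv/= andbT => xs.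
  have s1 : (1 < s)%R by exact: lt_trans xs.
  have s0 : (0 < s)%R by exact: lt_trans s1.
  rewrite (eq_integral (cst (s `^ (- b))%:E)); last first.
    by move=> t /set_mem St; rewrite fray.
  rewrite integral_sphere_cst -!EFinM; congr EFin.
  by rewrite powRD ?(gt_eqF s0) ?implybT//; ring.
rewrite integral_powR_tail// -!EFinM lee_fin le_eqVlt; apply/orP; left;
  apply/eqP.
by rewrite -/V; field; rewrite !gt_eqF.
Qed.

(** On 1 < s < r the radial integrand is a constant times s ^ (m pt) * s ^ (- 1 - d). The first
    power is at most r ^ (m pt), as m >= 0, and the second has integral 1 / d. For r <= 1 the
    truncation leaves nothing. *)
Lemma local_norm_radial_power_le r : (0 < r)%R ->
  local_norm pt p alpha r f <=
  (((N * V) `^ (pt / p) / ((m - (lam - e)) * pt)) `^ pt^-1 *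
    (if (1 < r)%R then r `^ m else 0))%:E.
Proof.
move=> r0; set d := ((m - (lam - e)) * pt)%R.
have d0 : (0 < d)%R by rewrite mulr_gt0// subr_gt0.
have NV0 : (0 < N * V)%R by rewrite mulr_gt0.
rewrite /local_norm.
set I := \int[_]_(_ in _) _.
have I0 : 0 <= I.
  by apply: integral_ge0 => s _; rewrite mule_ge0 ?poweR_ge0// lee_fin powR_ge0.
suff HI : I <= ((N * V) `^ (pt / p) / d * (if (1 < r)%R then r `^ (m * pt)
  else 0))%:E.
  apply: (@le_trans _ _ (((N * V) `^ (pt / p) / d *
      (if (1 < r)%R then r `^ (m * pt) else 0))%:E `^ pt^-1)).
    apply: gt0_ler_poweR => //;
      rewrite ?invr_ge0 ?(ltW pt0)// in_itv/= leey andbT//.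
    exact: le_trans HI.
  rewrite poweR_EFin lee_fin powRM.
  - rewrite ler_wpM2l ?powR_ge0//; case: ifP => _.
      by rewrite -powRrM mulfK ?gt_eqF.
    by rewrite powR0 ?invr_eq0 ?gt_eqF.
  - by rewrite divr_ge0 ?powR_ge0 ?(ltW d0).
  - by case: ifP => // _; rewrite powR_ge0.
pose k := ((N * V) `^ (pt / p))%R.
have k0 : (0 < k)%R by rewrite powR_gt0.
pose w := (if (1 < r)%R then r `^ (m * pt) else 0)%R.
have w0 : (0 <= w)%R by rewrite /w; case: ifP => // _; rewrite powR_ge0.
apply: (@le_trans _ _ (\int[mu]_(s in `]1%R, +oo[) ((k * w)%:E * (s `^ (- 1 -
  d))%:E))); last first.
  rewrite ge0_integralZl//; last 3 first.
  - by apply/measurable_EFinP/measurable_funTS; exact: measurable_powR.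
  - by move=> s _; rewrite lee_fin powR_ge0.
  - by rewrite lee_fin mulr_ge0// ltW.
  rewrite integral_powR_tail// powR1 -EFinM lee_fin le_eqVlt; apply/orP; left.
  by apply/eqP; rewrite mul1r mulrAC.
rewrite /I [leLHS]integral_mkcond [leRHS]integral_mkcond;
  apply: ge0_le_integral_nonmeasurable => s _.
  by apply: erestrict_ge0 => u _;
    rewrite mule_ge0 ?poweR_ge0// lee_fin powR_ge0.
rewrite /patch !mem_setE !in_itv/= andbT; case: ifPn => [/andP[s0 sr]|_];
  last first.
  by case: ifPn => // _; rewrite mule_ge0// lee_fin ?powR_ge0// mulr_ge0// ltW.
case: ifPn => s1; last first.
  rewrite integral0_eq ?poweR0r ?mul0e//; first by rewrite gt_eqF// divr_gt0.
  move=> t St; rewrite /f /radial_power enorm_tscale St mulr1 gtr0_norm//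
    (negbTE s1).
  by rewrite abse0 poweR0r// gt_eqF.
have r1 : (1 < r)%R by exact: lt_trans sr.
rewrite (eq_integral (cst ((s `^ (- b)) `^ p)%:E)); last first.
  by move=> t /set_mem St; rewrite fray// abse_EFin ger0_norm// powR_ge0.
rewrite integral_sphere_cst -(EFinM ((s `^ (- b)) `^ p)) poweR_EFin powRM
  ?powR_ge0 ?(ltW NV0)//.
rewrite -!powRrM -EFinM -EFinM lee_fin /w r1.
have -> : (- b * (p * (pt / p)) = - b * pt)%R by field; rewrite gt_eqF.
rewrite mulrAC -powRD ?(gt_eqF s0) ?implybT// mulrC -mulrA ler_wpM2l ?(ltW
  k0)//.
have -> : (- b * pt + (N - 1 + alpha) = m * pt + (- 1 - d))%R.
  have -> : (N - 1 + alpha = (a + lam) * pt - 1)%R by rewrite -beta1 /beta;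
    ring.
  by rewrite /b /d; ring.
rewrite powRD ?(gt_eqF s0) ?implybT// ler_wpM2r ?powR_ge0//.
by rewrite ge0_ler_powR ?nnegrE ?mulr_ge0 ?(ltW pt0) ?(ltW s0) ?(ltW r0) ?(ltW
  sr).
Qed.

Lemma LML_radial_power : LML pt lam q p alpha f.
Proof.
split; first by exists f => //; exact: aeW.
rewrite LML_normE.
pose c := (((N * V) `^ (pt / p) / ((m - (lam - e)) * pt)) `^ pt^-1)%R.
have c0 : (0 < c)%R.
  by rewrite powR_gt0// divr_gt0 ?powR_gt0 ?mulr_gt0// subr_gt0.
pose L2 r : \bar R := (if (1 < r)%R then r `^ m else 0)%:E.
have L20 r : 0 <= L2 r.
  by rewrite /L2 lee_fin; case: ifP => // _; rewrite powR_ge0.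
apply: (@le_lt_trans _ _ (c%:E * morrey_norm lam q L2)).
  apply: le_morrey_norm => // [r|r r0]; first exact: poweR_ge0.
  by rewrite -EFinM; exact: local_norm_radial_power_le.
rewrite lte_mul_pinfty ?lee_fin ?(ltW c0)//.
move: q q1 mq => [q'| |//]; rewrite ?lee_fin => q'1 mq'; last first.
  apply: (@le_lt_trans _ _ 1); last exact: ltry.
  apply: ge_ereal_sup => _ [r /=] + <-; rewrite in_itv/= andbT => r0.
  rewrite /L2 -EFinM lee_fin; case: ifPn => r1; last by rewrite mulr0.
  rewrite -powRD ?(gt_eqF r0) ?implybT// -[leRHS](powRr0 r).
  by rewrite ler_powR ?(ltW r1)// addrC subr_le0.
have q'0 : (0 < q')%R by exact: lt_le_trans q'1.
have {}mq' : (m < lam)%R by apply: mq'; rewrite ltry.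
apply: poweR_lty.
have dq0 : (0 < (lam - m) * q')%R by rewrite mulr_gt0// subr_gt0.
apply: (@le_lt_trans _ _ (\int[mu]_(r in `]1%R, +oo[) (r `^ (- 1 - (lam - m) *
  q'))%:E)).
  rewrite [leLHS]integral_mkcond [leRHS]integral_mkcond;
    apply: ge0_le_integral_nonmeasurable => r _.
    apply: erestrict_ge0 => u; rewrite /= in_itv/= andbT.
    exact: (@morrey_integrand_ge0 _ lam q' u L2).
  rewrite /patch !mem_setE !in_itv/= !andbT; case: ifPn => r0; last first.
    by case: ifPn => // _; rewrite lee_fin powR_ge0.
  rewrite /L2; case: ifPn => r1; last by rewrite mulr0 powR0 ?mul0e// gt_eqF.
  rewrite -EFinM lee_fin -powRD ?(gt_eqF r0) ?implybT//.
  rewrite -powRrM -(powR_inv1 (ltW r0)) -powRD ?(gt_eqF r0) ?implybT//.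
  rewrite le_eqVlt; apply/orP; left; apply/eqP.
  by apply: (congr1 (powR r)); ring.
by rewrite integral_powR_tail// ltry.
Qed.

Lemma LML_norm_radial_power_gt0 : 0 < LML_norm pt lam q p alpha f.
Proof.
rewrite LML_normE; pose L := radial_norm pt beta (angular_norm p f).
have -> : (fun r => local_norm pt p alpha r f) = L.
  by apply/funext => r; rewrite local_normE.
(* Any radius above 1 would do: the ball must reach beyond the truncation. *)
apply: (@morrey_norm_gt0 _ _ _ _ 2%R) => //.
- exact: radial_norm_nd.
- by move=> s; exact: radial_norm_ge0.
rewrite /L /radial_norm; apply: poweR_gt0.
pose F s := angular_norm p f s `^ pt * (s `^ beta)%:E.
apply: (@lt_le_trans _ _ (\int[mu]_(s in `]1%R, 2%R[) F s)); last first.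
  rewrite [leLHS]integral_mkcond [leRHS]integral_mkcond;
    apply: ge0_le_integral_nonmeasurable => s _.
    by apply: erestrict_ge0 => u _;
      rewrite mule_ge0 ?poweR_ge0// lee_fin powR_ge0.
  rewrite /patch !mem_setE !in_itv/=; case: ifPn => [/andP[s1 ->]|_].
    by rewrite (lt_trans ltr01 s1).
  by case: ifPn => // _; rewrite mule_ge0 ?poweR_ge0// lee_fin powR_ge0.
have I1 : 0 < mu `]1%R, 2%R[%classic.
  by rewrite lebesgue_measure_itv/= lte_fin ltr1n -EFinB lte_fin subr_gt0 ltr1n.
apply: integral_gt0 => //.
- apply: measurable_funTS; apply: emeasurable_funM.
    apply: (measurableT_comp (measurable_poweR _));
      exact: measurable_angular_norm.
  by apply/measurable_EFinP; exact: measurable_powR.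
- move=> s; rewrite /= in_itv/= => /andP[s1 _].
  have s0 : (0 < s)%R by exact: lt_trans s1.
  rewrite mule_gt0 ?lte_fin ?powR_gt0// poweR_gt0// /angular_norm poweR_gt0//.
  rewrite (eq_integral (cst ((s `^ (- b)) `^ p)%:E)); last first.
    by move=> t /set_mem St; rewrite fray// abse_EFin ger0_norm// powR_ge0.
  by rewrite integral_sphere_cst mule_gt0// lte_fin ?mulr_gt0 ?powR_gt0.
Qed.

Lemma dual_hardy_bound_ge (C : R) :
  (forall h : Rn R n -> \bar R, LML pt lam q p alpha h ->
    LML_norm pt lam q p alpha (dual_hardy h) <= C%:E * LML_norm pt lam q p
      alpha h) ->
  (N / b <= C)%R.
Proof.
move=> /(_ f LML_radial_power) HC.
have F0 := LML_norm_radial_power_gt0.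
have Foo : LML_norm pt lam q p alpha f < +oo by case: LML_radial_power.
have Nb0 : (0 < N / b)%R by rewrite divr_gt0.
have : (N / b)%:E * LML_norm pt lam q p alpha f <= C%:E * LML_norm pt lam q p
  alpha f.
  have NbN0 : (N / b != 0)%R by rewrite gt_eqF.
  apply: le_trans HC.
  have NbK (X : \bar R) : (N / b)%:E * ((N / b)^-1%:E * X) = X.
    by rewrite muleA -EFinM mulfV ?mul1e.
  have NbVK (X : \bar R) : (N / b)^-1%:E * ((N / b)%:E * X) = X.
    by rewrite muleA -EFinM mulVf ?mul1e.
  have Nbe : 0 < (N / b)%:E by rewrite lte_fin.
  (* [le_morrey_norm] has its constant on the larger side, so the pointwise lower bound is used as f
     <= (N / b)^-1 * H*f. *)
  rewrite -[leRHS]NbK (lee_pmul2l _ Nbe); last by [].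
  rewrite !LML_normE.
  apply: le_morrey_norm => //.
  - by rewrite invr_gt0.
  - by move=> r; exact: poweR_ge0.
  - by move=> r; exact: poweR_ge0.
  move=> r _; apply: le_local_norm => [|x]; first by rewrite invr_gt0.
  have Hx := le_dual_hardy_radial_power x.
  have Hx0 : 0 <= dual_hardy f x.
    by apply: le_trans Hx; rewrite mule_ge0// lee_fin ltW.
  rewrite !gee0_abs//.
  rewrite -[leLHS]NbVK.
  by rewrite lee_pmul2l// lte_fin invr_gt0.
have Ffin : LML_norm pt lam q p alpha f \is a fin_num.
  by rewrite ge0_fin_numE// ltW.
by rewrite lee_pmul2r// lee_fin.
Qed.

End power_function.

End norm_of_dual_hardy.

Theorem theorem3p2 (R : realType) (n : nat) (p pt : R) (q : \bar R)
    (alpha lam : R)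
    (hn : (2 <= n)%N) (hp : 1 <= p) (hpt : 1 <= pt) (hq : (1 <= q)%E)
    (hlam0 : 0 <= lam) (hlam : lam < (n%:R + alpha) / pt)
    (hlamq : (q < +oo)%E -> 0 < lam) :
  let C : R := n%:R * pt / (n%:R + alpha - lam * pt) in
  (forall f : Rn R n -> \bar R, LML pt lam q p alpha f ->
     LML pt lam q p alpha (dual_hardy f) /\
     (LML_norm pt lam q p alpha (dual_hardy f)
        <= C%:E * LML_norm pt lam q p alpha f)%E) /\
  operator_norm pt lam q p alpha (@dual_hardy R n) = C%:E.
Proof.
move=> C; have n0 : (0 < n)%N by exact: leq_trans hn.
have pt0 : 0 < pt by exact: lt_le_trans hpt.
have N0 : 0 < n%:R :> R by rewrite ltr0n.
pose a := (n%:R + alpha) / pt - lam; have a0 : 0 < a by rewrite subr_gt0.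
have CE : C = n%:R / a.
  have -> : a = (n%:R + alpha - lam * pt) / pt.
    by rewrite mulrBl mulfK// gt_eqF.
  by rewrite invf_div mulrA.
clearbody C; have C0 : 0 <= C by rewrite CE divr_ge0// ltW.
have bound (f : Rn R n -> \bar R) : LML pt lam q p alpha f -> (LML_norm pt lam
  q p alpha (dual_hardy f)
    <= C%:E * LML_norm pt lam q p alpha f)%E.
  move=> Lf; rewrite CE.
  exact: (LML_norm_dual_hardy_le n0 hp hpt hq a0 hlam0 Lf).
split=> [f Lf|]; first by split;
  [exact: (LML_dual_hardy n0 hp hpt hq a0 hlam0 Lf)|exact: bound].
apply/eqP; rewrite eq_le; apply/andP; split.
  by apply: ereal_inf_lbound; exists C.
apply: le_ereal_inf_tmp => _ [K [K0 HK] <-]; rewrite lee_fin.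
(* For finite q the cap e <= lam will keep m = lam - e / 2 nonnegative; for q = +oo any positive cap
   works. *)
pose e1 := if (q < +oo)%E then lam else 1.
have e10 : 0 < e1 by rewrite /e1; case: ifP.
have KE e : 0 < e -> e <= e1 -> n%:R / (a + e) <= K.
  (* For finite q, m must lie strictly between lam - e and lam, and the midpoint is taken; for q =
     +oo the value lam itself is allowed. *)
  move=> e0 ee1; pose m := if (q < +oo)%E then lam - e / 2 else lam.
  apply: (dual_hardy_bound_ge n0 hp hpt hq a0 e0 _ _ _ _ HK (m := m)).
  - rewrite /m; case: ifPn => // qoo; move: ee1; rewrite /e1 qoo; lra.
  - by rewrite /m; case: ifP => // _; lra.
  - by move=> qoo; rewrite /m qoo; lra.
  - by rewrite /m; case: ifP => // _; lra.
rewrite CE ler_pdivrMr// leNgt; apply/negP => KaN.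
(* If K a < n, this e makes K e smaller than the gap n - K a, against n <= K (a + e). The summand 1
   covers K = 0. *)
pose e := Num.min e1 ((n%:R - K * a) / (2 * (K + 1))).
have K10 : 0 < 2 * (K + 1) by lra.
have e0 : 0 < e by rewrite lt_min e10 divr_gt0// subr_gt0.
have ee1 : e <= e1 by rewrite ge_min lexx.
have : n%:R <= K * (a + e) by rewrite -ler_pdivrMr ?KE// addr_gt0.
have : e * (2 * (K + 1)) <= n%:R - K * a.
  by rewrite -ler_pdivlMr// ge_min lexx orbT.
have : 0 < e * (K + 1) by rewrite mulr_gt0//; lra.
have : 0 <= K * e by rewrite mulr_ge0// ltW.
clearbody a e; nra.
Qed.
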